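(* Let $\lambda\in\mathbb R$ and let $v:\overline{\mathcal P}_2\times\mathbb R^d\to\mathbb R^d$, $(\rho,x)\mapsto v[\rho](x)$, be a demicontinuous velocity field. Suppose that for any $\rho^{(0)},\rho^{(1)}\in\overline{\mathcal P}_2$ and $\gamma^*\in\Gamma^*(\rho^{(0)},\rho^{(1)})$ it holds that $$-\int \langle x-y,\,v[\rho^{(0)}](x)-v[\rho^{(1)}](y)\rangle\,\mathrm d\gamma^*(x,y)\ \ge\ \lambda\int\|x-y\|^2\,\mathrm d\gamma^*(x,y).$$ Then for any $\rho^{(0)},\rho^{(1)}\in\overline{\mathcal P}_2$ and any $\gamma\in\Gamma(\rho^{(0)},\rho^{(1)})$, $$-\int \langle x-y,\,v[\rho^{(0)}](x)-v[\rho^{(1)}](y)\rangle\,\mathrm d\gamma(x,y)\ \ge\ \lambda\int\|x-y\|^2\,\mathrm d\gamma(x,y).$$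
   Context: Fix $n\ge 1$ and dimensions $d_1,\dots,d_n$, $d=\sum_{i=1}^n d_i$; write $x=[x_1,\dots,x_n]\in\mathbb R^d$ with $x_i\in\mathbb R^{d_i}$. $\mathcal P_2(\mathbb R^k)$ is the set of Borel probability measures on $\mathbb R^k$ with finite second moment, $\mathscr W_2$ is the Wasserstein-2 metric, $\overline{\mathcal P}_2=\mathcal P_2(\mathbb R^{d_1})\times\cdots\times\mathcal P_2(\mathbb R^{d_n})$, with elements $\rho=[\rho_1,\dots,\rho_n]$, metrized by $\overline{\mathscr W}_2(\rho,\mu)^2=\sum_{i=1}^n\mathscr W_2(\rho_i,\mu_i)^2$. $\Gamma_i(\rho_i,\mu_i)$ is the set of couplings of $\rho_i$ and $\mu_i$, and $\Gamma_i^*(\rho_i,\mu_i)\subseteq\Gamma_i(\rho_i,\mu_i)$ is the set of optimal ones, i.e. minimizers of $\int\|x_i-y_i\|^2\mathrm d\gamma_i$. $\Gamma(\rho,\mu)=\prod_i\Gamma_i(\rho_i,\mu_i)$ and $\Gamma^*(\rho,\mu)=\prod_i\Gamma_i^*(\rho_i,\mu_i)$; an element $(\gamma_1,\dots,\gamma_n)$ is identified with the product measure $\mathrm d\gamma(x,y)=\prod_i\mathrm d\gamma_i(x_i,y_i)$. Similarly $\mathrm d\rho(x)=\prod_i\mathrm d\rho_i(x_i)$. A velocity field has the form $v[\rho](x)=[v_1[\rho](x_1),\dots,v_n[\rho](x_n)]$ with $v_i[\rho]:\mathbb R^{d_i}\to\mathbb R^{d_i}$, where each $v_i[\rho]$ may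 depend on all of $\rho$. Strong-weak convergence: for $x^{(k)},v^{(k)}\in\mathbb R^d$, $(x^{(k)},v^{(k)})\overset{sw}{\to}(x,v)$ means $x^{(k)}\to x$ and $f(v^{(k)})\to f(v)$ for every bounded linear functional $f$ on $\mathbb R^d$. $C_2^{sw}$ is the set of functions $\zeta:\mathbb R^d\times\mathbb R^d\to\mathbb R$ such that $\lim_k\zeta(x^{(k)},v^{(k)})=\zeta(x,v)$ whenever $(x^{(k)},v^{(k)})\overset{sw}{\to}(x,v)$, and for every $\varepsilon>0$ there is $A_\varepsilon\ge0$ with $|\zeta(x,v)|\le A_\varepsilon(1+\|x\|^2)+\varepsilon\|v\|^2$ for all $(x,v)$. Demicontinuity: $v$ is demicontinuous at $\rho$ if for any sequence $\rho^{(k)}\to\rho$ in $(\overline{\mathcal P}_2,\overline{\mathscr W}_2)$, $\lim_{k\to\infty}\int\zeta(x,v[\rho^{(k)}](x))\,\mathrm d\rho^{(k)}(x)=\int\zeta(x,v[\rho](x))\,\mathrm d\rho(x)$ for all $\zeta\in C_2^{sw}$. $v$ is demicontinuous if this holds at every $\rho\in\overline{\mathcal P}_2$. *)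

(* Defs.v *)
From HB Require Import structures.
From mathcomp Require Import all_boot all_order all_algebra.
From mathcomp Require Import all_classical all_reals all_analysis.

Set Implicit Arguments.
Unset Strict Implicit.
Unset Printing Implicit Defensive.
Import Order.TTheory GRing.Theory Num.Theory.
Import numFieldNormedType.Exports.

Local Open Scope classical_set_scope.
Local Open Scope ring_scope.

Definition matrix_borel_display : measure_display.
Proof. exact: default_measure_display. Qed.

Section matrix_borel.
Context (R : realType) (m k : nat).

HB.instance Definition _ := @isMeasurable.Build matrix_borel_display
  'M[R]_(m, k) <<s (@open 'M[R]_(m, k)) >>
  (@sigma_algebra0 _ setT _) (@sigma_algebraC _ _)
  (@sigma_algebra_bigcup _ setT _).

End matrix_borel.

(* `|x| on 'rV_k is the sup norm, hence a separate Euclidean norm. *)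
Definition dotp (R : realType) (k : nat) (x y : 'rV[R]_k) : R :=
  \sum_(j < k) x 0 j * y 0 j.

Definition enorm (R : realType) (k : nat) (x : 'rV[R]_k) : R :=
  Num.sqrt (dotp x x).

Definition dprod (I : finType) (d : measure_display)
  (T : I -> measurableType d) : Type := forall i, T i.

Definition dprod_display : measure_display -> measure_display.
Proof. exact. Qed.

Section dprod_measurable.
Context (I : finType) (d : measure_display) (T : I -> measurableType d).

HB.instance Definition _ := gen_eqMixin (dprod T).
HB.instance Definition _ := gen_choiceMixin (dprod T).
HB.instance Definition _ := isPointed.Build (dprod T) (fun=> point).

Definition dprod_cylinders : set (set (dprod T)) :=
  \bigcup_(i : I) preimage_set_system setT (fun f : dprod T => f i) measurable.

HB.instance Definition _ := @isMeasurable.Build (dprod_display d) (dprod T)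
  <<s dprod_cylinders >>
  (@sigma_algebra0 _ setT _) (@sigma_algebraC _ _)
  (@sigma_algebra_bigcup _ setT _).

Lemma measurable_dprod_proj i : measurable_fun setT (fun f : dprod T => f i).
Proof.
move=> _ A mA; apply: sub_sigma_algebra; exists i => //.
by exists A.
Qed.

Lemma measurable_to_dprod d' (X : measurableType d') (g : X -> dprod T) :
  (forall i, measurable_fun setT (fun x => g x i)) -> measurable_fun setT g.
Proof.
move=> mg _ A; rewrite setTI => mA.
suff : <<s dprod_cylinders >> `<=` [set B | measurable (g @^-1` B)] by apply.
apply: smallest_sub.
  split => [|B /= mB|F /= mF].
  - by rewrite /= preimage_set0.
  - by rewrite setTD preimage_setC; exact: measurableC.
  - by rewrite preimage_bigcup; exact: bigcup_measurable.
move=> B [i _] [C mC <-] /=; rewrite setTI.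
by have := mg i measurableT C mC; rewrite setTI.
Qed.

Definition dprod_upd (i : I) (p : T i * dprod T) : dprod T := @eqtype.dfwith I T p.2 i p.1.

Lemma measurable_dprod_upd i : measurable_fun setT (@dprod_upd i).
Proof.
apply: measurable_to_dprod => j; rewrite /dprod_upd /eqtype.dfwith.
case: eqP => [ij|_].
  by case: j / ij => /=; exact: measurable_fst.
exact: (measurableT_comp (@measurable_dprod_proj j) measurable_snd).
Qed.

HB.instance Definition _ (i : I) := isMeasurableFun.Build _ _ _ _
  (@dprod_upd i) (@measurable_dprod_upd i).

End dprod_measurable.

(* The product measure of a finite family: starting from a point mass, the
   coordinates are overwritten one after the other by an independent draw. *)
Section prod_prob.
Context (R : realType) (I : finType) (d : measure_display).
Context (T : I -> measurableType d) (P : forall i, probability (T i) R).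

Definition prod_prob_step (i : I) (Q : probability (dprod T) R) :
  probability (dprod T) R := distribution (P i \x Q)%E (@dprod_upd _ _ T i).

Definition prod_prob : probability (dprod T) R :=
  foldr prod_prob_step (dirac point) (enum I).

Lemma measurable_box (A : forall i, set (T i)) :
  (forall i, measurable (A i)) ->
  measurable [set f : dprod T | forall i, A i (f i)].
Proof.
move=> mA.
rewrite (_ : [set _ | _] =
  \bigcap_(i in [set` enum I]) ((fun f : dprod T => f i) @^-1` A i)).
  apply: fin_bigcap_measurable => // i _.
  have := @measurable_dprod_proj _ _ T i measurableT (A i) (mA i).
  by rewrite setTI.
apply/seteqP; split => f /= fA i; first by move=> _; exact: fA.
by apply: fA; rewrite /= mem_enum.
Qed.

Lemma foldr_prod_prob_step_box (s : seq I) (A : forall i, set (T i)) :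
  uniq s -> (forall i, measurable (A i)) ->
  (foldr prod_prob_step (dirac point) s : probability (dprod T) R)
    [set f | forall i, A i (f i)] =
  ((\prod_(i <- s) P i (A i)) *
   (dirac (point : dprod T) : probability (dprod T) R)
     [set f | forall i, i \notin s -> A i (f i)])%E.
Proof.
elim: s A => [|i s IHs] A /= => [_ mA|/andP[is_ us] mA].
  rewrite big_nil mul1e; congr (dirac _ _).
  by apply/seteqP; split => f /= fA j; [move=> _|]; apply: fA.
pose A' j : set (T j) := if j == i then setT else A j.
have mA' j : measurable (A' j) by rewrite /A'; case: ifP.
rewrite /distribution /pushforward.
set Q := foldr _ _ _.
rewrite (_ : _ @^-1` _ = A i `*` [set f | forall j, A' j (f j)]); last first.
  apply/seteqP; split => -[a f] /=.
    move=> fA; split => [|j].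
      by have := fA i; rewrite /dprod_upd eqtype.dfwith_in.
    rewrite /A'; case: eqVneq => // ji.
    by have := fA j; rewrite /dprod_upd eqtype.dfwith_out// eq_sym.
  move=> [Aa fA] j; rewrite /dprod_upd /=.
  case: eqtype.dfwithP => // {}j ij.
  by have := fA j; rewrite /A' eq_sym (negbTE ij).
rewrite product_measure1E//; last exact: measurable_box.
rewrite [X in (_ * X)%E](IHs A' us mA') big_cons -muleA; congr (_ * (_ * _))%E.
  rewrite big_seq [RHS]big_seq; apply: eq_bigr => j js.
  by rewrite /A'; case: eqVneq => // ji; rewrite -ji js in is_.
congr (dirac _ _).
apply/seteqP; split => f /= fA j; have := fA j; rewrite /A' in_cons.
  case: eqVneq => //= _ + js; exact.
by case: eqVneq => //= _ + js; exact.
Qed.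

Lemma prod_prob_box (A : forall i, set (T i)) :
  (forall i, measurable (A i)) ->
  prod_prob [set f | forall i, A i (f i)] = (\prod_(i : I) P i (A i))%E.
Proof.
move=> mA; rewrite /prod_prob foldr_prod_prob_step_box ?enum_uniq//.
rewrite big_enum/= (_ : [set _ | _] = setT) ?diracT ?mule1//.
by apply/seteqP; split => f //= _ i; rewrite mem_enum.
Qed.

End prod_prob.

Section wasserstein.
Context (R : realType).
Local Open Scope ereal_scope.

Record P2 (k : nat) : Type := MkP2 {
  P2_prob :> probability 'rV[R]_k R ;
  P2_moment : \int[P2_prob]_x (enorm x ^+ 2)%:E < +oo }.

Section one_species.
Context (k : nat).
Implicit Types (mu nu : P2 k) (g : probability ('rV[R]_k * 'rV[R]_k)%type R).

(* The marginals are compared on Borel sets only: a measure is a function on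
   all sets, with unspecified values on the non-measurable ones. *)
Definition coupling mu nu : set (probability ('rV[R]_k * 'rV[R]_k)%type R) :=
  [set g | forall A : set 'rV[R]_k, measurable A ->
     pushforward g fst A = mu A /\ pushforward g snd A = nu A].

Definition cost g : \bar R := \int[g]_p (enorm (p.1 - p.2) ^+ 2)%:E.

Definition optimal_coupling mu nu :
    set (probability ('rV[R]_k * 'rV[R]_k)%type R) :=
  [set g | coupling mu nu g /\
     forall g', coupling mu nu g' -> cost g <= cost g'].

Definition W2 mu nu : \bar R :=
  ereal_inf [set cost g | g in coupling mu nu] `^ 2^-1.

End one_species.

Context (n : nat) (d : 'I_n -> nat).

(* No positivity is imposed on the dimensions: R^0 is allowed. *)
Definition P2bar : Type := forall i, P2 (d i).

Definition W2bar (rho mu : P2bar) : \bar R :=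
  (\sum_(i < n) W2 (rho i) (mu i) ^+ 2) `^ 2^-1.

Definition couplings (rho mu : P2bar) :
    set (forall i, probability ('rV[R]_(d i) * 'rV[R]_(d i))%type R) :=
  [set g | forall i, coupling (rho i) (mu i) (g i)].

Definition optimal_couplings (rho mu : P2bar) :
    set (forall i, probability ('rV[R]_(d i) * 'rV[R]_(d i))%type R) :=
  [set g | forall i, optimal_coupling (rho i) (mu i) (g i)].

Definition P2bar_cvg (rhok : nat -> P2bar) (rho : P2bar) : Prop :=
  W2bar (rhok k) rho @[k --> \oo] --> 0.

End wasserstein.

Section fields.
Context (R : realType) (n : nat) (d : 'I_n -> nat).

Notation "'Rd'" := ('rV[R]_(\sum_(i < n) d i)).

Definition velocity_field : Type :=
  P2bar R d -> forall i, 'rV[R]_(d i) -> 'rV[R]_(d i).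

Definition field_at (v : velocity_field) (rho : P2bar R d) (x : Rd) : Rd :=
  \mxrow_(i < n) v rho i (submxrow x i).

Definition concat (x : dprod (fun i => 'rV[R]_(d i))) : Rd :=
  \mxrow_(i < n) x i.

Definition coupled_space := dprod (fun i => ('rV[R]_(d i) * 'rV[R]_(d i))%type).

Definition xpart (w : coupled_space) : Rd := \mxrow_(i < n) (w i).1.
Definition ypart (w : coupled_space) : Rd := \mxrow_(i < n) (w i).2.

Definition sw_cvg (xk vk : nat -> Rd) (x v : Rd) : Prop :=
  xk k @[k --> \oo] --> x /\
  forall f : {scalar Rd}, (exists M : R, forall u, `|f u| <= M * enorm u) ->
    f (vk k) @[k --> \oo] --> f v.

Definition C2sw (zeta : Rd -> Rd -> R) : Prop :=
  (forall (xk vk : nat -> Rd) (x v : Rd), sw_cvg xk vk x v ->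
     zeta (xk k) (vk k) @[k --> \oo] --> zeta x v) /\
  (forall eps : R, 0 < eps -> exists2 A : R, 0 <= A &
     forall x v : Rd,
       `|zeta x v| <= A * (1 + enorm x ^+ 2) + eps * enorm v ^+ 2).

Definition test_fun (v : velocity_field) (zeta : Rd -> Rd -> R)
    (rho : P2bar R d) (x : dprod (fun i => 'rV[R]_(d i))) : \bar R :=
  (zeta (concat x) (field_at v rho (concat x)))%:E.

(* Integrability expresses that the integrals are well defined and finite; in
   particular it entails the Borel measurability of x |-> v[rho](x). *)
Definition demicontinuous_at (v : velocity_field) (rho : P2bar R d) : Prop :=
  forall rhok : nat -> P2bar R d, P2bar_cvg rhok rho ->
  forall zeta, C2sw zeta ->
  [/\ forall k, (prod_prob (rhok k)).-integrable setT (test_fun v zeta (rhok k)),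
      (prod_prob rho).-integrable setT (test_fun v zeta rho) &
      (\int[prod_prob (rhok k)]_x test_fun v zeta (rhok k) x)%E
        @[k --> \oo] --> (\int[prod_prob rho]_x test_fun v zeta rho x)%E].

Definition demicontinuous (v : velocity_field) : Prop :=
  forall rho : P2bar R d, demicontinuous_at v rho.

End fields.

(* Main.v *)
Require Import Defs.
From HB Require Import structures.
From mathcomp Require Import all_boot all_order all_algebra.
From mathcomp Require Import all_classical all_reals all_analysis.
From mathcomp Require Import measurable_realfun.
From mathcomp Require Import ring lra.
Set Implicit Arguments.
Unset Strict Implicit.
Unset Printing Implicit Defensive.
Import Order.TTheory GRing.Theory Num.Theory.
Import numFieldNormedType.Exports.
Local Open Scope classical_set_scope.
Local Open Scope ring_scope.

(** Optimality is a local property of couplings that charge finitely many pairs,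
    and this is what turns an inequality along optimal couplings into one along
    all couplings.

    Suppose that each factor g_i charges finitely many pairs (x, y), move x to y
    along the segment X_t = (1 - t) x + t y, and let rho_t be the law of X_t. For
    s close enough to t, each X_t is a nearest point to X_s among the finitely
    many points charged by rho_t, even if trajectories cross at time t; hence the
    law of (X_t, X_s) is an optimal coupling of rho_t and rho_s
    ([near_nearest_finite], [nearest_point_optimal]). Since X_s - X_t is
    (s - t) (y - x), the inequality along this coupling says that
    psi t = E <y - x, v[rho_t](X_t)> + lambda t E |y - x|^2 satisfies
    (psi s - psi t) (s - t) <= 0 for s close to t ([interp_step]). Such a local
    comparison at every t gives psi 1 <= psi 0 ([locally_decreasing01]), which is
    the claim for the product of the g_i ([finitely_supported_monotone]).

    A general coupling is pushed forward by a coordinatewise quantization of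
    finite range. The quantized marginals converge in the Wasserstein distance,
    and one has to pass to the limit in E <Y_N, V_N>, where Y_N is the quantized
    y - x, which converges in L2, and V_N is the velocity at the quantized
    position. As Y_N is not a function of that position, this expectation is not
    an integral of a test function. It converges nevertheless as soon as V_N is
    bounded in L2 and converges in L1 ([cvg_Rintegral_mul]), and demicontinuity
    gives both facts. If the second moments of V_N were unbounded, a gliding hump
    would produce a test function of growth o(|v|^2) with unbounded integrals
    ([vel_L2_bound]). For the L1 convergence, the limit velocity is approximated
    in L1 by a bounded continuous function b of the position
    ([approximable_on_product]), and |v - b(x)| is used as a test function
    ([vel_cvg_L1]). *)

(** * Square-integrable functions and dominated convergence *)

Section real_facts.
Context (R : realType).

(** Young's inequality; it makes [|y|] an admissible growth, of order o(y^2), for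
    test functions. *)
Lemma norm_le_sqr (e y : R) : 0 < e -> `|y| <= e^-1 + e * y ^+ 2.
Proof.
move=> e0; have -> : y = e^-1 * (e * y) by rewrite mulrA mulVf ?mul1r// gt_eqF.
rewrite normrM gtr0_norm ?invr_gt0//.
have -> : e * (e^-1 * (e * y)) ^+ 2 = e^-1 * (e * y) ^+ 2 by field; rewrite gt_eqF.
rewrite -{2}[e^-1]mulr1 -mulrDr ler_pM2l ?invr_gt0// ler_norml.
have h1 := sqr_ge0 (e * y - 1); have h2 := sqr_ge0 (e * y + 1).
by move: (e * y) h1 h2 => z h1 h2; apply/andP; split; nra.
Qed.

Lemma norm_cvg_le (u : nat -> R) (l b : R) :
  u k @[k --> \oo] --> l -> (forall k, `|u k| <= b) -> `|l| <= b.
Proof.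
move=> cu ub; have cn : `|u k| @[k --> \oo] --> `|l| by exact: cvg_norm.
rewrite -(cvg_lim _ cn)//; apply: limr_le; first by apply/cvg_ex; exists `|l|.
by near=> k; exact: ub.
Unshelve. all: by end_near. Qed.

End real_facts.

Section square_integrable.
Context (R : realType) (dd : measure_display) (T : measurableType dd).
Context (P : probability T R).
Implicit Types f g : T -> R.

Lemma integrable_le f g : measurable_fun setT f ->
  P.-integrable setT (EFin \o g) -> (forall x, `|f x| <= g x) ->
  P.-integrable setT (EFin \o f).
Proof.
move=> mf ig fg; apply: le_integrable ig => //; first exact/measurable_EFinP.
by move=> x _ /=; rewrite lee_fin (le_trans (fg x))// ler_norm.
Qed.

Lemma bounded_integrable f (M : R) : measurable_fun setT f ->
  (forall x, `|f x| <= M) -> P.-integrable setT (EFin \o f).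
Proof.
move=> mf fM; apply: (@integrable_le _ (cst M)) => //.
exact: finite_measure_integrable_cst.
Qed.

Lemma indicator_integrable (A : set T) : measurable A ->
  P.-integrable setT (EFin \o (\1_A : T -> R)).
Proof.
move=> mA; apply: (@bounded_integrable _ 1) => // x.
by rewrite indicE ger0_norm// lern1 leq_b1.
Qed.

Lemma integrable_addr f g : P.-integrable setT (EFin \o f) ->
  P.-integrable setT (EFin \o g) ->
  P.-integrable setT (EFin \o (fun x => f x + g x)).
Proof. by move=> fi gi; exact: (integrableD measurableT fi gi). Qed.

Lemma integrable_dist f g : P.-integrable setT (EFin \o f) ->
  P.-integrable setT (EFin \o g) ->
  P.-integrable setT (EFin \o (fun x => `|f x - g x|)).
Proof.
move=> fi gi; apply: (@integrable_abse _ _ _ P setT (EFin \o (fun x => f x - g x))).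
exact: (integrableB measurableT fi gi).
Qed.

Definition sqint f :=
  measurable_fun setT f /\ P.-integrable setT (EFin \o (fun x => f x ^+ 2)).

Lemma sqint_measurable f : sqint f -> measurable_fun setT f. Proof. by case. Qed.

Lemma sqint_le f g : measurable_fun setT f -> sqint g ->
  (forall x, `|f x| <= `|g x|) -> sqint f.
Proof.
move=> mf [mg ig] fg; split => //; apply: integrable_le ig _ => //.
  exact: measurable_funX.
by move=> x; rewrite normrX -[leRHS]real_normK ?num_real// lerXn2r ?nnegrE.
Qed.

Lemma sqint_mul f g : sqint f -> sqint g ->
  P.-integrable setT (EFin \o (fun x => f x * g x)).
Proof.
move=> [mf if2] [mg ig2]; apply: (@integrable_le _ (fun x => f x ^+ 2 + g x ^+ 2)).
- exact: measurable_funM.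
- exact: (integrableD measurableT if2 ig2).
move=> x; rewrite ler_norml; have h1 := sqr_ge0 (f x - g x).
have h2 := sqr_ge0 (f x + g x); apply/andP; split; nra.
Qed.

Lemma sqint_cst (c : R) : sqint (cst c).
Proof. by split => //; exact: (finite_measure_integrable_cst P (c ^+ 2)). Qed.

Lemma sqint_integrable f : sqint f -> P.-integrable setT (EFin \o f).
Proof.
move=> sf; have := sqint_mul sf (sqint_cst 1).
by under [X in EFin \o X]eq_fun do rewrite mulr1.
Qed.

Lemma sqintD f g : sqint f -> sqint g -> sqint (fun x => f x + g x).
Proof.
move=> sf sg; have := sqint_mul sf sg.
case: sf sg => mf if2 [mg ig2] ifg; split; first exact: measurable_funD.
have := integrableD measurableT (integrableD measurableT if2 ig2)
  (integrableZl measurableT 2 ifg).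
apply: eq_integrable => // x _ /=; rewrite -EFinM -!EFinD.
by congr (_%:E); ring.
Qed.

Lemma sqintZ (c : R) f : sqint f -> sqint (fun x => c * f x).
Proof.
move=> [mf if2]; split; first exact: measurable_funM.
have := integrableZl measurableT (c ^+ 2) if2.
by apply: eq_integrable => // x _ /=; rewrite -EFinM exprMn.
Qed.

Lemma sqintB f g : sqint f -> sqint g -> sqint (fun x => f x - g x).
Proof.
move=> sf sg; have := sqintD sf (sqintZ (-1) sg).
by under [X in sqint X -> _]eq_fun do rewrite mulN1r.
Qed.

Lemma cvg_Rintegral_dominated (f_ : nat -> T -> R) f g :
  (forall k, measurable_fun setT (f_ k)) ->
  (forall x, f_ k x @[k --> \oo] --> f x) ->
  P.-integrable setT (EFin \o g) ->
  (forall k x, `|f_ k x| <= g x) ->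
  \int[P]_x f_ k x @[k --> \oo] --> \int[P]_x f x.
Proof.
move=> mf cf ig fg; apply: fine_cvg.
have mlim : measurable_fun setT f.
  by apply: (@measurable_fun_cvg _ _ R setT f_ f) => // x _; exact: cf.
have ifl : P.-integrable setT (EFin \o f).
  by apply: (integrable_le mlim ig) => x; exact: (norm_cvg_le (cf x) (fun k => fg k x)).
rewrite fineK; last exact: integrable_fin_num.
apply: (@dominated_cvg _ _ _ P setT measurableT
  (fun k => EFin \o f_ k) (EFin \o f) (EFin \o g)) => //.
- by move=> k; exact/measurable_EFinP.
- by move=> x _; apply: cvg_EFin; [exact: nearW|exact: cf].
- by move=> k x _; rewrite lee_fin.
Qed.

Lemma Rintegral_norm_sub_le f g : P.-integrable setT (EFin \o f) ->
  P.-integrable setT (EFin \o g) ->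
  `|\int[P]_x f x - \int[P]_x g x| <= \int[P]_x `|f x - g x|.
Proof.
move=> ifi ig; rewrite -RintegralB//.
apply: (@le_normr_Rintegral _ _ _ P setT (fun x => f x - g x)) => //.
exact: (integrableB measurableT ifi ig).
Qed.

End square_integrable.

(** * Pairing a bounded sequence of L2 with a convergent one *)

Section weak_strong.
Context (R : realType) (dd : measure_display) (T : measurableType dd).
Context (P : probability T R).
Local Notation E f := (\int[P]_x f x).

Lemma Rintegral_tail (f : T -> R) : sqint P f ->
  E (fun x => if n%:R < `|f x| then f x ^+ 2 else 0) @[n --> \oo] --> 0.
Proof.
move=> [mf if2].
suff : E (fun x => if n%:R < `|f x| then f x ^+ 2 else 0) @[n --> \oo] -->
    E (fun=> 0) by rewrite Rintegral_cst// mul0r.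
apply: (@cvg_Rintegral_dominated _ _ _ P _ _ (fun x => f x ^+ 2)) => //.
- move=> n; apply: measurable_fun_ifT => //.
    apply: measurable_fun_ltr => //; exact: measurableT_comp.
  exact: measurable_funX.
- move=> x; apply: cvg_near_cst; near=> n.
  rewrite ifF//; apply/negbTE; rewrite -leNgt.
  by near: n; exact: nbhs_infty_ger.
- move=> n x; case: ifP => _; last by rewrite normr0 sqr_ge0.
  by rewrite ger0_norm// sqr_ge0.
Unshelve. all: by end_near. Qed.

(** A sequence bounded in L2 and convergent in L1 converges weakly in L2, so it may
    be paired with a sequence that converges in L2. To see it, [Y] is cut at a
    level [n]: below the cut the L1 convergence is enough, and above it the L2
    bound applies, with a factor that is small because [Y] is square-integrable. *)
Lemma cvg_Rintegral_mul (Y_ V_ : nat -> T -> R) (Y V : T -> R) (C : R) :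
  (forall k, sqint P (Y_ k)) -> sqint P Y ->
  (forall k, sqint P (V_ k)) -> sqint P V ->
  (forall k, E (fun x => V_ k x ^+ 2) <= C) -> E (fun x => V x ^+ 2) <= C ->
  E (fun x => (Y_ k x - Y x) ^+ 2) @[k --> \oo] --> 0 ->
  E (fun x => `|V_ k x - V x|) @[k --> \oo] --> 0 ->
  E (fun x => Y_ k x * V_ k x) @[k --> \oo] --> E (fun x => Y x * V x).
Proof.
move=> sY_ sY sV_ sV bV_ bV cY cV.
have C0 : 0 <= C by apply: le_trans bV; apply: Rintegral_ge0 => x _; exact: sqr_ge0.
pose h n x := if n%:R < `|Y x| then Y x ^+ 2 else 0.
have ih n : P.-integrable setT (EFin \o h n).
  case: sY => mY iY2; apply: (integrable_le _ iY2) => [|x].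
    apply: measurable_fun_ifT => //; last exact: measurable_funX.
    by apply: measurable_fun_ltr => //; exact: measurableT_comp.
  by rewrite /h; case: ifP => _; rewrite ?normr0 ?sqr_ge0// ger0_norm ?sqr_ge0.
have idV k : P.-integrable setT (EFin \o (fun x => `|V_ k x - V x|)).
  have /sqint_integrable iv := sqintB (sV_ k) sV.
  exact: (integrable_abse iv).
have idY k := (sqintB (sY_ k) sY).2.
(* Young's inequality with parameter [M], and the cut of [Y] at level [n]; [M] is
   chosen first, then [n], then [k]. *)
have key (M : R) n k : 0 < M ->
    `|E (fun x => Y_ k x * V_ k x) - E (fun x => Y x * V x)| <=
    M * E (fun x => (Y_ k x - Y x) ^+ 2) + n%:R * E (fun x => `|V_ k x - V x|)
    + M * E (h n) + 5 * C / M.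
  move=> M0.
  apply: le_trans (Rintegral_norm_sub_le (sqint_mul (sY_ k) (sV_ k)) (sqint_mul sY sV)) _.
  pose b x := (M * (Y_ k x - Y x) ^+ 2 + n%:R * `|V_ k x - V x|) +
    (M * h n x + M^-1 * (3 * V_ k x ^+ 2 + 2 * V x ^+ 2)).
  have i1 := integrableZl measurableT M (idY k).
  have i2 := integrableZl measurableT n%:R (idV k).
  have i3 := integrableZl measurableT M (ih n).
  have i4 := integrableZl measurableT 3 (sV_ k).2.
  have i5 := integrableZl measurableT 2 sV.2.
  have i45 := integrableD measurableT i4 i5.
  have i6 := integrableZl measurableT M^-1 i45.
  have i12 := integrableD measurableT i1 i2.
  have i36 := integrableD measurableT i3 i6.
  have ib := integrableD measurableT i12 i36.
  apply: (@le_trans _ _ (E b)).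
    apply: le_Rintegral => //.
      apply: (@integrable_abse _ _ _ P setT (EFin \o (fun x => Y_ k x * V_ k x - Y x * V x))).
      exact: (integrableB measurableT (sqint_mul (sY_ k) (sV_ k)) (sqint_mul sY sV)).
    move=> x _; rewrite /b.
    have -> : Y_ k x * V_ k x - Y x * V x =
      (Y_ k x - Y x) * V_ k x + Y x * (V_ k x - V x) by ring.
    have yg (a c : R) : `|a * c| <= M * a ^+ 2 + M^-1 * c ^+ 2.
      have -> : c = M * (M^-1 * c) by rewrite mulrA mulfV ?gt_eqF// mul1r.
      set c' := M^-1 * c.
      have -> : M^-1 * (M * c') ^+ 2 = M * c' ^+ 2 by field; rewrite gt_eqF.
      rewrite mulrCA normrM (gtr0_norm M0) -mulrDr ler_pM2l// ler_norml.
      have h1 := sqr_ge0 (a - c'); have h2 := sqr_ge0 (a + c').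
      apply/andP; split; nra.
    apply: le_trans (ler_normD _ _) _.
    have e1 := yg (Y_ k x - Y x) (V_ k x).
    have e2 : `|Y x * (V_ k x - V x)| <= n%:R * `|V_ k x - V x| +
        (M * h n x + M^-1 * (2 * V_ k x ^+ 2 + 2 * V x ^+ 2)).
      have r0 : 0 <= M^-1 * (2 * V_ k x ^+ 2 + 2 * V x ^+ 2).
        apply: mulr_ge0; first by rewrite invr_ge0 ltW.
        by apply: addr_ge0; apply: mulr_ge0 => //; exact: sqr_ge0.
      rewrite /h; case: ltP => hn.
        have := yg (Y x) (V_ k x - V x).
        have : (V_ k x - V x) ^+ 2 <= 2 * V_ k x ^+ 2 + 2 * V x ^+ 2.
          have h2 := sqr_ge0 (V_ k x + V x); nra.
        rewrite -(ler_pM2l (_ : 0 < M^-1)) ?invr_gt0// => q1 q2.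
        have q3 : 0 <= n%:R * `|V_ k x - V x| by rewrite mulr_ge0.
        lra.
      rewrite mulr0 add0r normrM.
      have := ler_wpM2r (normr_ge0 (V_ k x - V x)) hn; lra.
    lra.
  have -> : E b = M * E (fun x => (Y_ k x - Y x) ^+ 2) +
      n%:R * E (fun x => `|V_ k x - V x|) + (M * E (h n) +
      M^-1 * (3 * E (fun x => V_ k x ^+ 2) + 2 * E (fun x => V x ^+ 2))).
    rewrite -!RintegralZl//; [|exact: sV.2|exact: (sV_ k).2].
    by rewrite -!RintegralD// -RintegralZl// -!RintegralD.
  rewrite !addrA lerD2l mulrC ler_pM2r ?invr_gt0//.
  have := bV_ k; have := bV; lra.
apply/cvgrPdist_le => /= e e0.
have C1 : 0 < C + 1 by lra.
pose M := 20 * (C + 1) / e.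
have M0 : 0 < M by rewrite divr_gt0// mulr_gt0.
have hM : 5 * C / M <= e / 4.
  rewrite ler_pdivrMr// /M (_ : e / 4 * _ = 5 * (C + 1)); first lra.
  by field; rewrite gt_eqF.
have e4 : 0 < e / 4 by lra.
have [n hn] : exists n, M * E (h n) <= e / 4.
  have p0 : 0 < e / 4 / M by rewrite divr_gt0.
  have /cvgrPdist_le/(_ _ p0)[n _ /(_ n (leqnn n))] := Rintegral_tail sY.
  rewrite sub0r normrN => q; exists n.
  by rewrite mulrC -ler_pdivlMr// (le_trans (ler_norm _) q).
have n1 : 0 < n%:R + 1 :> R by rewrite ltr_wpDl.
move/cvgrPdist_le : cY => /(_ (e / 4 / M)) cY.
move/cvgrPdist_le : cV => /(_ (e / 4 / (n%:R + 1))) cV.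
near=> k.
rewrite distrC (le_trans (key M n k M0))//.
have a1 : M * E (fun x => (Y_ k x - Y x) ^+ 2) <= e / 4.
  rewrite mulrC -ler_pdivlMr// (le_trans (ler_norm _))//.
  rewrite -normrN -sub0r.
  by near: k; apply: cY; rewrite divr_gt0.
have a2 : n%:R * E (fun x => `|V_ k x - V x|) <= e / 4.
  apply: (@le_trans _ _ ((n%:R + 1) * E (fun x => `|V_ k x - V x|))).
    rewrite ler_wpM2r// ?lerDl//; apply: Rintegral_ge0 => x _; exact: normr_ge0.
  rewrite mulrC -ler_pdivlMr// (le_trans (ler_norm _))//.
  rewrite -normrN -sub0r.
  by near: k; apply: cV; rewrite divr_gt0.
lra.
Unshelve. all: by end_near. Qed.

End weak_strong.

(** * Laws of maps and change of variables *)

Section change_of_variables.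
Context (R : realType) (d1 d2 : measure_display).
Context (T1 : measurableType d1) (T2 : measurableType d2).

(** Equality of the image measure with [Q] is asked on measurable sets only, since
    the values of a measure elsewhere carry no meaning. *)
Definition has_law (P : probability T1 R) (Z : T1 -> T2) (Q : probability T2 R) :=
  forall A, measurable A -> Q A = P (Z @^-1` A).

Variables (P : probability T1 R) (Z : T1 -> T2) (Q : probability T2 R).
Hypotheses (mZ : measurable_fun setT Z) (lZ : has_law P Z Q).

Lemma ge0_integral_law (h : T2 -> \bar R) : measurable_fun setT h ->
  (forall y, 0 <= h y)%E -> (\int[Q]_y h y = \int[P]_x h (Z x))%E.
Proof.
move=> mh h0.
rewrite -(@ge0_integral_pushforward _ _ _ _ _ _ mZ P setT h)//.
by apply: eq_measure_integral => A mA _; exact: lZ.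
Qed.

Lemma integral_law (h : T2 -> \bar R) : measurable_fun setT h ->
  (\int[Q]_y h y = \int[P]_x h (Z x))%E.
Proof.
move=> mh; rewrite integralE [RHS]integralE; congr (_ - _)%E.
  rewrite (ge0_integral_law (measurable_funepos mh)); last by move=> y; exact: funepos_ge0.
  by apply: eq_integral => x _; rewrite -[RHS]/((h \o Z)^\+ x)%E (funepos_comp h Z).
rewrite (ge0_integral_law (measurable_funeneg mh)); last by move=> y; exact: funeneg_ge0.
by apply: eq_integral => x _; rewrite -[RHS]/((h \o Z)^\- x)%E (funeneg_comp h Z).
Qed.

Lemma Rintegral_law (h : T2 -> R) : measurable_fun setT h ->
  \int[Q]_y h y = \int[P]_x h (Z x).
Proof. by move=> mh; rewrite /Rintegral integral_law//; exact/measurable_EFinP. Qed.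

Lemma integrable_law (h : T2 -> \bar R) : Q.-integrable setT h ->
  P.-integrable setT (h \o Z).
Proof.
move=> /integrableP[mh ih]; apply/integrableP; split.
  exact: measurableT_comp.
rewrite -(ge0_integral_law (h := fun y => `|h y|%E))//.
exact: measurableT_comp.
Qed.

End change_of_variables.

Section image_law.
Context (R : realType) (d1 d2 : measure_display).
Context (T1 : measurableType d1) (T2 : measurableType d2).

Definition image_law (P : probability T1 R) (Z : T1 -> T2)
    (mZ : measurable_fun setT Z) : probability T2 R :=
  distribution P (HB.pack Z (isMeasurableFun.Build _ _ _ _ _ mZ)
    : {mfun T1 >-> T2}).

Lemma image_lawP P Z mZ : has_law P Z (@image_law P Z mZ).
Proof. by []. Qed.

End image_law.

Section product_law.
Context (R : realType) (I : finType) (d1 d2 : measure_display).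
Context (T1 : I -> measurableType d1) (T2 : I -> measurableType d2).
Context (P : forall i, probability (T1 i) R) (Z : forall i, T1 i -> T2 i).
Context (Q : forall i, probability (T2 i) R).
Hypotheses (mZ : forall i, measurable_fun setT (@Z i)).
Hypotheses (lZ : forall i, has_law (P i) (@Z i) (Q i)).

Definition dprod_map (w : dprod T1) : dprod T2 := fun i => Z (w i).

Lemma measurable_dprod_map : measurable_fun setT dprod_map.
Proof.
apply: measurable_to_dprod => i.
exact: measurableT_comp (@mZ i) (@measurable_dprod_proj _ _ T1 i).
Qed.

(** The two measures agree on boxes, which form a generating pi-system. *)
Lemma prod_prob_law : has_law (prod_prob P) dprod_map (prod_prob Q).
Proof.
pose G := [set B : set (dprod T2) | exists2 A : forall i, set (T2 i),
  (forall i, measurable (A i)) & B = [set f | forall i, A i (f i)]].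
have GT : G setT by exists (fun=> setT) => //; apply/seteqP; split.
move=> A mA; rewrite -[RHS]/(image_law (prod_prob P) measurable_dprod_map A).
apply: (@measure_unique _ _ _ G (fun=> setT)) => //.
- apply/seteqP; split.
    apply: smallest_sub; first exact: smallest_sigma_algebra.
    move=> B [i _] [C mC <-]; apply: sub_sigma_algebra.
    (* the box with side [C] at [i] and full sides elsewhere *)
    exists (fun j => [set y | forall e : i = j, C (eq_rect_r T2 y e)]).
      move=> j; have [ij|ij] := pselect (i = j).
        case: j / ij; rewrite (_ : [set _ | _] = C)//.
        apply/seteqP; split => y /=; first by move=> /(_ erefl).
        by move=> Cy e; rewrite (Prop_irrelevance e erefl).
      by rewrite (_ : [set _ | _] = setT)//; apply/seteqP; split => // y _ e; case: (ij e).
    apply/seteqP; split => f /=; last by move=> /(_ i erefl).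
    by move=> [_ Cf] j e; case: j / e.
  apply: smallest_sub; first exact: smallest_sigma_algebra.
  by move=> _ [B mB ->]; exact: measurable_box.
- move=> _ _ [B mB ->] [C mC ->]; exists (fun i => B i `&` C i).
    by move=> i; exact: measurableI.
  apply/seteqP; split => f /=.
    by move=> [Bf Cf] i; split.
  by move=> BC; split => i; have [] := BC i.
- by rewrite bigcup_const//; exists 0%N.
- move=> _ [B mB ->].
  have mZB i : measurable (@Z i @^-1` B i).
    by have := @mZ i measurableT _ (mB i); rewrite setTI.
  transitivity (\prod_(i : I) Q i (B i))%E; first exact: prod_prob_box.
  transitivity (\prod_(i : I) P i (@Z i @^-1` B i))%E.
    by apply: eq_bigr => i _; apply: lZ; exact: mB.
  by symmetry; exact: (prod_prob_box P mZB).
- move=> _; apply: (le_lt_trans (@probability_le1 _ _ _ (prod_prob Q) setT measurableT)).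
  exact: ltry.
Qed.

End product_law.

(** * Density in L1 of a lattice of bounded functions *)

Section function_lattice_density.
Import HBSimple.
Context (R : realType) (dd : measure_display) (T : measurableType dd).
Context (P : probability T R) (C : set (T -> R)).
Hypothesis Ccst : forall a : R, C (cst a).
Hypothesis CD : forall c1 c2, C c1 -> C c2 -> C (fun x => c1 x + c2 x).
Hypothesis CZ : forall a c, C c -> C (fun x => a * c x).
Hypothesis Cmax : forall c1 c2, C c1 -> C c2 -> C (fun x => Num.max (c1 x) (c2 x)).
Hypothesis Cmeas : forall c, C c -> measurable_fun setT c.
Hypothesis Cbnd : forall c, C c -> exists M, forall x, `|c x| <= M.

(** Membership of [f] in the closure of [C] for the L1 distance. *)
Definition approximable (f : T -> R) := P.-integrable setT (EFin \o f) /\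
  forall e, 0 < e -> exists2 c, C c & \int[P]_x `|f x - c x| <= e.

Let Cint c : C c -> P.-integrable setT (EFin \o c).
Proof. by move=> Cc; have [M cM] := Cbnd Cc; apply: bounded_integrable cM; exact: Cmeas. Qed.

Lemma approximable_trans f : P.-integrable setT (EFin \o f) ->
  (forall e, 0 < e -> exists2 g, approximable g & \int[P]_x `|f x - g x| <= e) ->
  approximable f.
Proof.
move=> fi fe; split => // e e0.
have [|g [gi ge] fg] := fe (e / 2); first by rewrite divr_gt0.
have [|c Cc gc] := ge (e / 2); first by rewrite divr_gt0.
exists c => //; rewrite [e](splitr e).
apply: le_trans (lerD fg gc).
rewrite -RintegralD//; [|exact: integrable_dist|by apply: integrable_dist => //; exact: Cint].
apply: le_Rintegral => //.
- by apply: integrable_dist => //; exact: Cint.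
- by apply: integrable_addr => //; apply: integrable_dist => //; exact: Cint.
by move=> x _; rewrite (le_trans _ (ler_normD _ _))// addrA subrK.
Qed.

Lemma approximable_cst a : approximable (cst a).
Proof.
split; first exact: Cint.
move=> e e0; exists (cst a) => //.
under eq_Rintegral do rewrite subrr normr0.
by rewrite Rintegral_cst// mul0r ltW.
Qed.

Let approximable_op2 (op : R -> R -> R) f g :
  (forall c1 c2, C c1 -> C c2 -> C (fun x => op (c1 x) (c2 x))) ->
  P.-integrable setT (EFin \o (fun x => op (f x) (g x))) ->
  (forall a b a' b', `|op a b - op a' b'| <= `|a - a'| + `|b - b'|) ->
  approximable f -> approximable g -> approximable (fun x => op (f x) (g x)).
Proof.
move=> Cop iop lop [fi fe] [gi ge]; split=> // e e0.
have [|c Cc fc] := fe (e / 2); first by rewrite divr_gt0.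
have [|c' Cc' gc] := ge (e / 2); first by rewrite divr_gt0.
exists (fun x => op (c x) (c' x)); first exact: Cop.
rewrite [e](splitr e); apply: le_trans (lerD fc gc).
rewrite -RintegralD//; [|by apply: integrable_dist => //; exact: Cint..].
apply: le_Rintegral => //.
- by apply: integrable_dist => //; apply: Cint; exact: Cop.
- by apply: integrable_addr => //; apply: integrable_dist => //; exact: Cint.
Qed.

Lemma approximableD f g : approximable f -> approximable g ->
  approximable (fun x => f x + g x).
Proof.
move=> af ag; apply: approximable_op2 => //.
  by case: af ag => fi _ [gi _]; exact: integrable_addr.
by move=> a b a' b'; rewrite (le_trans _ (ler_normD _ _))// opprD addrACA.
Qed.

Lemma approximableZ a f : approximable f -> approximable (fun x => a * f x).
Proof.
move=> [fi fe]; split; first exact: (integrableZl measurableT a fi).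
move=> e e0; have a1 : 0 < `|a| + 1 by rewrite ltr_wpDl.
have [|c Cc fc] := fe (e / (`|a| + 1)); first by rewrite divr_gt0.
exists (fun x => a * c x); first exact: CZ.
rewrite (@eq_Rintegral _ _ _ P setT (fun x => `|a| * `|f x - c x|)); last first.
  by move=> x _; rewrite -mulrBr normrM.
rewrite RintegralZl//; last by apply: integrable_dist => //; exact: Cint.
move: fc; rewrite ler_pdivlMr// => fc.
apply: le_trans fc; rewrite mulrC ler_wpM2l//.
  by apply: Rintegral_ge0 => x _; exact: normr_ge0.
by rewrite lerDl.
Qed.

Lemma approximable_indicU A B : measurable A -> measurable B ->
  approximable (\1_A) -> approximable (\1_B) -> approximable (\1_(A `|` B)).
Proof.
move=> mA mB aA aB.
have -> : \1_(A `|` B) = (fun x => Num.max (\1_A x) (\1_B x)) :> (T -> R).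
  apply/funext => x; rewrite !indicE in_setU.
  by rewrite /Num.max; case: (x \in A); case: (x \in B) => /=; rewrite ?ltxx ?ltr01 ?ltr10.
apply: approximable_op2 => //.
  apply: (@bounded_integrable _ _ _ P _ 1) => [|x].
    exact: measurable_maxr.
  by rewrite !indicE /Num.max; case: ifP => _; rewrite ger0_norm// lern1 leq_b1.
move=> a b a' b'; rewrite /Num.max ler_norml.
have /andP[p1 p2] : - `|a - a'| <= a - a' <= `|a - a'| by rewrite -ler_norml.
have /andP[q1 q2] : - `|b - b'| <= b - b' <= `|b - b'| by rewrite -ler_norml.
by case: ltP => h; case: ltP => h'; lra.
Qed.

(** The sets whose indicator belongs to the closure of [C] form a sigma-algebra:
    complements come from constants and linear combinations, finite unions from
    [Num.max], and a countable union is the L1 limit of the finite ones. *)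
Lemma approximable_sigma (G : set (set T)) :
  (forall A, G A -> measurable A /\ approximable (\1_A)) ->
  forall A, <<s G >> A -> measurable A /\ approximable (\1_A).
Proof.
move=> aG; apply: smallest_sub => //; split.
- by split => //; rewrite indic0; exact: approximable_cst.
- move=> A [mA aA]; split; first by rewrite setTD; exact: measurableC.
  have -> : \1_(setT `\` A) = (fun x => 1 + (-1) * \1_A x) :> (T -> R).
    apply/funext => x; rewrite setTD !indicE in_setC.
    by case: (x \in A); rewrite /= ?mulr1 ?subrr// mulr0 addr0.
  apply: approximableD; [exact: approximable_cst|exact: approximableZ].
- move=> A aA; have mU : measurable (\bigcup_k A k).
    by apply: bigcup_measurable => k _; case: (aA k).
  split => //.
  pose U k := \big[setU/set0]_(i < k) A i.
  have mUk k : measurable (U k) by apply: bigsetU_measurable => i _; case: (aA i).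
  have aU k : approximable (\1_(U k)).
    elim: k => [|k ih]; first by rewrite /U big_ord0 indic0; exact: approximable_cst.
    rewrite /U big_ord_recr/=; apply: approximable_indicU => //; try by case: (aA k).
    exact: mUk.
  apply: approximable_trans; first exact: indicator_integrable.
  move=> e e0.
  suff : \int[P]_x `|\1_(\bigcup_k A k) x - \1_(U k) x| @[k --> \oo] --> 0.
    move=> /cvgrPdist_le/(_ _ e0)[k _ /(_ k (leqnn k))].
    rewrite sub0r normrN => h; exists (\1_(U k)); first exact: aU.
    exact: le_trans (ler_norm _) h.
  suff : \int[P]_x `|\1_(\bigcup_k A k) x - \1_(U k) x| @[k --> \oo] --> \int[P]__ (0 : R).
    by rewrite Rintegral_cst// mul0r.
  apply: (@cvg_Rintegral_dominated _ _ _ P _ _ (cst 1)).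
  + by move=> k; apply: measurableT_comp => //; exact: measurable_funB.
  + move=> x; apply: cvg_near_cst.
    have [[i _ Aix]|nAx] := pselect ((\bigcup_k A k) x).
      exists i.+1 => // k /= ik; rewrite !indicE.
      have -> : x \in \bigcup_k A k by rewrite inE; exists i.
      have -> : x \in U k by rewrite inE /U -bigcup_mkord; exists i.
      by rewrite subrr normr0.
    apply: nearW => k; rewrite !indicE.
    have -> : (x \in \bigcup_k A k) = false by rewrite memNset.
    have -> : (x \in U k) = false.
      by rewrite memNset// /U -bigcup_mkord => -[i _ Ai]; apply: nAx; exists i.
    by rewrite subrr normr0.
  + exact: finite_measure_integrable_cst.
  + move=> k x; rewrite normr_id !indicE ler_norml.
    by case: (_ \in _); case: (_ \in _) => /=; apply/andP; split; lra.
Qed.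

(** Simple functions are dense in L1, and they are linear combinations of
    indicators. *)
Lemma approximable_integrable (G : set (set T)) :
  measurable = <<s G >> -> (forall A, G A -> approximable (\1_A)) ->
  forall f, P.-integrable setT (EFin \o f) -> approximable f.
Proof.
move=> mG aG f fi.
have aA A : measurable A -> approximable (\1_A).
  rewrite mG => GA; apply: (approximable_sigma _ GA).2 => B GB; split; last exact: aG.
  by rewrite mG; exact: sub_sigma_algebra.
apply: approximable_trans => // e e0.
have [g [gi _ fg]] := approximation_sfun_integrable measurableT fi.
have /fine_cvg/cvgrPdist_le/(_ _ e0)[k _ /(_ k (leqnn k))] := fg.
rewrite /= sub0r normrN => h.
exists (g k); last exact: le_trans (ler_norm _) h.
rewrite (_ : (g k : T -> R) =
  fun x => \sum_(y \in range (g k)) y * \1_(g k @^-1` [set y]) x); last first.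
  by apply/funext => x; exact: fimfunE.
have fr : finite_set (range (g k)) by exact: fimfunP.
under [X in approximable X]eq_fun do rewrite fsbig_finite//.
elim: (finmap.enum_fset _) => [|y s ih].
  by under [X in approximable X]eq_fun do rewrite big_nil; exact: approximable_cst.
under [X in approximable X]eq_fun do rewrite big_cons.
apply: approximableD => //; apply: approximableZ; apply: aA.
exact: measurable_sfunP.
Qed.

End function_lattice_density.

(** * Lipschitz suprema and approximation of Borel sets *)

Section lipschitz_sup.
Context (R : realType) (I S : Type) (h : I -> S -> R) (D : S -> S -> R) (i0 : I).
Hypothesis hD : forall i x y, `|h i x - h i y| <= D x y.
Hypothesis hbnd : forall x, exists M, forall i, h i x <= M.

Definition sup_family (x : S) : R := sup (range (h^~ x)).

Lemma sup_family_ge i x : h i x <= sup_family x.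
Proof.
apply: ub_le_sup; last by exists i.
by have [M hM] := hbnd x; exists M => _ [j _ <-]; exact: hM.
Qed.

Lemma sup_family_le x M : (forall i, h i x <= M) -> sup_family x <= M.
Proof.
move=> hM; apply: ge_sup; first by exists (h i0 x); exists i0.
by move=> _ [j _ <-]; exact: hM.
Qed.

(** A common modulus of continuity passes to the supremum, whatever the index type.
    This yields continuous functions defined by infinitely many constraints: the
    approximants of an open set, and the slowly growing function [slow]. *)
Lemma sup_family_lipschitz x y : `|sup_family x - sup_family y| <= D x y.
Proof.
rewrite ler_norml; apply/andP; split.
  suff : sup_family y <= D x y + sup_family x by move=> ?; lra.
  apply: (@sup_family_le y) => i.
  have := hD i x y; rewrite ler_norml => /andP[h1 _].
  by have h2 := sup_family_ge i x; lra.
suff : sup_family x <= D x y + sup_family y by move=> ?; lra.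
apply: (@sup_family_le x) => i.
have := hD i x y; rewrite ler_norml => /andP[_ h1].
by have h2 := sup_family_ge i y; lra.
Qed.

End lipschitz_sup.

Section continuous_density.
Context (R : realType).

Lemma lipschitz_continuous (V W : pseudoMetricNormedZmodType R) (f : V -> W) (L : R) :
  (forall x y, `|f x - f y| <= L * `|x - y|) -> continuous f.
Proof.
move=> fL x; apply/cvgrPdist_le => /= e e0.
have L1 : 0 < `|L| + 1 by rewrite ltr_wpDl.
have eL : 0 < e / (`|L| + 1) by rewrite divr_gt0.
near=> y.
apply: le_trans (fL x y) _.
apply: (@le_trans _ _ ((`|L| + 1) * `|x - y|)).
  by rewrite ler_wpM2r// (le_trans (ler_norm L))// lerDl.
rewrite mulrC -ler_pdivlMr//.
Unshelve. all: by end_near. Qed.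

Definition bounded_continuous (V : topologicalType) : set (V -> R) :=
  [set f | continuous f /\ exists M, forall x, `|f x| <= M].

Section closure.
Context (V : topologicalType).
Implicit Types f g : V -> R.

Lemma bounded_continuous_cst (a : R) : bounded_continuous (cst a : V -> R).
Proof. by split; [move=> x; exact: cvg_cst|exists `|a|]. Qed.

Lemma bounded_continuousD f g : bounded_continuous f -> bounded_continuous g ->
  bounded_continuous (fun x => f x + g x).
Proof.
move=> [cf [M fM]] [cg [N gN]]; split; first by move=> x; exact: (cvgD (cf x) (cg x)).
by exists (M + N) => x; rewrite (le_trans (ler_normD _ _))// lerD.
Qed.

Lemma bounded_continuousZ a f : bounded_continuous f ->
  bounded_continuous (fun x => a * f x).
Proof.
move=> [cf [M fM]]; split; first by move=> x; apply: cvgM; [exact: cvg_cst|exact: cf].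
by exists (`|a| * M) => x; rewrite normrM ler_wpM2l.
Qed.

Lemma bounded_continuous_max f g : bounded_continuous f -> bounded_continuous g ->
  bounded_continuous (fun x => Num.max (f x) (g x)).
Proof.
move=> [cf [M fM]] [cg [N gN]]; split.
  under eq_fun do rewrite maxr_absE.
  move=> x; apply: cvgM; last exact: cvg_cst.
  apply: cvgD; first exact: (cvgD (cf x) (cg x)).
  by apply: cvg_norm; exact: (cvgB (cf x) (cg x)).
exists (M + N) => x; have := fM x; have := gN x.
have := normr_ge0 (f x); have := normr_ge0 (g x).
by rewrite /Num.max; case: ifP => _; lra.
Qed.

End closure.

Context (k : nat).
Local Notation V := ('rV[R]_k).

Lemma continuous_borel (f : V -> R) : continuous f -> measurable_fun setT f.
Proof.
move=> cf; apply: (measurability _ (RGenOInfty.measurableE R)) => _ [_ [x ->] <-].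
rewrite setTI; apply: sub_sigma_algebra.
by apply: open_comp => // y _; exact: cf.
Qed.

(** The indicator of [U] is the pointwise limit of the [n]-Lipschitz functions
    1 - sup_z max (0, 1 - n |x - z|), with [z] outside [U]. *)
Lemma open_approximable (P : probability V R) (U : set V) : open U ->
  approximable P (@bounded_continuous V) (\1_U).
Proof.
move=> oU; have mU : measurable U by exact: sub_sigma_algebra.
split; first exact: indicator_integrable.
(* Letting [z] range over the whole space, with value 0 on [U], keeps the family
   nonempty when [U] is everything. *)
pose h n (z x : V) := if z \in U then 0 else Num.max 0 (1 - n%:R * `|x - z|) : R.
have hL n z x y : `|h n z x - h n z y| <= n%:R * `|x - y|.
  rewrite /h; case: ifP => _; first by rewrite subrr normr0 mulr_ge0.
  have : n%:R * `| `|x - z| - `|y - z| | <= n%:R * `|x - y| :> R.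
    rewrite ler_wpM2l//; apply: le_trans (ler_dist_dist _ _) _.
    by rewrite opprB addrA subrK.
  rewrite -[X in X * _]ger0_norm// -normrM mulrBr ler_norml => /andP[h1 h2].
  by rewrite /Num.max ler_norml; case: ltP => q1; case: ltP => q2; apply/andP; split; lra.
have h01 n z x : 0 <= h n z x <= 1.
  rewrite /h; case: ifP => _; first by rewrite lexx ler01.
  have : 0 <= n%:R * `|x - z| by rewrite mulr_ge0.
  by rewrite /Num.max; case: ltP => q1 q2; apply/andP; split; lra.
have hb n x : exists M, forall z, h n z x <= M.
  by exists 1 => z; case/andP: (h01 n z x).
pose f n x := 1 - sup_family (h n) x.
have fL n x y : `|f n x - f n y| <= n%:R * `|x - y|.
  have -> : f n x - f n y = sup_family (h n) y - sup_family (h n) x by rewrite /f; ring.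
  rewrite distrC.
  exact: (@sup_family_lipschitz _ _ _ _ (fun x y => n%:R * `|x - y|) 0 (hL n) (hb n)).
have f01 n x : 0 <= f n x <= 1.
  have s0 := @sup_family_ge _ _ _ _ (hb n) 0 x.
  have s1 : sup_family (h n) x <= 1.
    by apply: (sup_family_le 0) => z; case/andP: (h01 n z x).
  have /andP[h0 _] := h01 n 0 x.
  by apply/andP; rewrite /f; split; lra.
have fC n : bounded_continuous (f n).
  split; first exact: (lipschitz_continuous (fL n)).
  by exists 1 => x; have /andP[? ?] := f01 n x; rewrite ger0_norm.
move=> e e0.
suff : \int[P]_x `|\1_U x - f n x| @[n --> \oo] --> 0.
  move=> /cvgrPdist_le/(_ _ e0)[n _ /(_ n (leqnn n))].
  rewrite sub0r normrN => q; exists (f n); first exact: fC.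
  exact: le_trans (ler_norm _) q.
suff : \int[P]_x `|\1_U x - f n x| @[n --> \oo] --> \int[P]__ (0 : R).
  by rewrite Rintegral_cst// mul0r.
apply: (@cvg_Rintegral_dominated _ _ _ P _ _ (cst 1)).
- move=> n; apply: measurableT_comp => //; apply: measurable_funB => //.
  by apply: continuous_borel; case: (fC n).
- move=> x; apply: cvg_near_cst; have [Ux|nUx] := pselect (U x).
    have : nbhs x U by exact: open_nbhs_nbhs.
    move=> /nbhs_ballP[r /= r0 rU].
    near=> n.
    suff -> : f n x = 1 by rewrite indicE mem_set// subrr normr0.
    rewrite /f; suff -> : sup_family (h n) x = 0 by rewrite subr0.
    apply/eqP; rewrite eq_le; apply/andP; split.
      apply: (sup_family_le 0) => z; rewrite /h; case: ifPn => // /negP zU.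
      rewrite ge_max lexx/= subr_le0.
      have xz : r <= `|x - z|.
        rewrite leNgt; apply/negP => xzr; apply: zU; rewrite inE; apply: rU.
        by rewrite -ball_normE.
      apply: (@le_trans _ _ (r^-1 * r)); first by rewrite mulVf// gt_eqF.
      have rn : r^-1 <= n%:R by near: n; exact: nbhs_infty_ger.
      by apply: ler_pM => //; rewrite ?invr_ge0 ltW.
    apply: le_trans (@sup_family_ge _ _ _ _ (hb n) 0 x).
    by have /andP[] := h01 n 0 x.
  apply: nearW => n.
  have : 1 <= sup_family (h n) x.
    apply: le_trans (@sup_family_ge _ _ _ _ (hb n) x x).
    by rewrite /h memNset// subrr normr0 mulr0 subr0 le_max lexx orbT.
  have /andP[+ _] := f01 n x; rewrite {1}/f => q1 q2.
  have -> : f n x = 0 by rewrite /f; lra.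
  by rewrite indicE memNset// subr0 normr0.
- exact: finite_measure_integrable_cst.
- move=> n x; rewrite normr_id indicE ler_norml.
  have /andP[? ?] := f01 n x.
  by case: (_ \in _) => /=; apply/andP; split; lra.
Unshelve. all: by end_near. Qed.

Lemma borel_approximable (P : probability V R) (A : set V) : measurable A ->
  approximable P (@bounded_continuous V) (\1_A).
Proof.
move=> mA; apply: (approximable_sigma _ _ _ _ _ _ _ mA).2.
- exact: bounded_continuous_cst.
- exact: bounded_continuousD.
- exact: bounded_continuousZ.
- exact: bounded_continuous_max.
- by move=> c [cc _]; exact: continuous_borel.
- by move=> c [].
- move=> U oU; split; first exact: sub_sigma_algebra.
  exact: open_approximable.
Qed.

End continuous_density.

(** * Continuous functions on the product of the blocks *)

Section product_density.
Context (R : realType) (n : nat) (d : 'I_n -> nat).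
Local Notation Rd := ('rV[R]_(\sum_(i < n) d i)).
Local Notation X := (dprod (fun i => 'rV[R]_(d i))).

Lemma concatK (x : X) i : submxrow (concat x) i = x i.
Proof. by rewrite /concat mxrowK. Qed.

Lemma submxrow_continuous i : continuous (fun x : Rd => submxrow x i).
Proof.
apply: (@lipschitz_continuous _ _ _ _ 1) => x y.
rewrite -submxrowB mul1r; set z := x - y.
rewrite -[leLHS]/(mx_norm _) -[leRHS]/(mx_norm _) !mx_normrE; apply: bigmax_le => [|[a b] _].
  exact: bigmax_ge_id.
rewrite mxE.
exact: (le_bigmax _ (fun ij : 'I_1 * 'I_(\sum_(i < n) d i) => `|z ij.1 ij.2|) (a, _)).
Qed.

(** The sigma-algebra of the product is generated by the blocks, and nothing relates
    it directly to the Borel sets of R^d; measurability of the composite with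
    [concat] is therefore recorded next to continuity. *)
Definition continuous_on_product : set (X -> R) :=
  [set c | measurable_fun setT c /\
           exists2 b : Rd -> R, bounded_continuous b & c = b \o @concat R n d].

(** [borel_approximable] is applied to the law of the [i]-th block, and the
    approximant is read as a function on R^d through [submxrow]. *)
Lemma cylinder_approximable (Q : probability X R) (A : set X) :
  @dprod_cylinders _ _ (fun i => 'rV[R]_(d i)) A ->
  approximable Q continuous_on_product (\1_A).
Proof.
move=> [i _ [B mB <-]].
have mp := @measurable_dprod_proj _ _ (fun i => 'rV[R]_(d i)) i.
have mA : measurable (setT `&` (fun f : X => f i) @^-1` B) by exact: mp.
split; first exact: indicator_integrable.
move=> e e0.
have [_ /(_ _ e0)[c [cc [M cM]] h]] := borel_approximable (image_law Q mp) mB.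
have mc := continuous_borel cc.
exists (fun x => c (x i)).
  split; first exact: measurableT_comp.
  exists (fun x => c (submxrow x i)); last by apply/funext => x /=; rewrite concatK.
  split; last by exists M.
  move=> x; apply: (@continuous_comp _ _ _ (fun x : Rd => submxrow x i) c).
    exact: submxrow_continuous.
  exact: cc.
rewrite setTI; apply: le_trans h.
rewrite le_eqVlt; apply/orP; left; apply/eqP.
rewrite (@Rintegral_law _ _ _ _ _ _ _ _ mp (@image_lawP _ _ _ _ _ Q _ mp)
  (fun y => `|\1_B y - c y|))//.
by apply: measurableT_comp => //; exact: measurable_funB.
Qed.

Lemma approximable_on_product (Q : probability X R) (f : X -> R) (e : R) : 0 < e ->
  Q.-integrable setT (EFin \o f) ->
  exists b : Rd -> R, [/\ bounded_continuous b, measurable_fun setT (b \o @concat R n d)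
    & \int[Q]_x `|f x - b (concat x)| <= e].
Proof.
move=> e0 fi.
suff [_ /(_ _ e0)[c [mc [b Cb cE]] h]] : approximable Q continuous_on_product f.
  by exists b; split => //; [rewrite -cE|move: h; rewrite cE].
apply: (approximable_integrable _ _ _ _ _ _ _ (@cylinder_approximable Q)) => //.
- move=> a; split; first exact: measurable_cst.
  by exists (cst a) => //; exact: bounded_continuous_cst.
- move=> c1 c2 [m1 [b1 C1 e1]] [m2 [b2 C2 e2]]; split; first exact: measurable_funD.
  by exists (fun x => b1 x + b2 x); [exact: bounded_continuousD|rewrite e1 e2].
- move=> a c1 [m1 [b1 C1 e1]]; split; first exact: measurable_funM.
  by exists (fun x => a * b1 x); [exact: bounded_continuousZ|rewrite e1].
- move=> c1 c2 [m1 [b1 C1 e1]] [m2 [b2 C2 e2]]; split; first exact: measurable_maxr.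
  by exists (fun x => Num.max (b1 x) (b2 x)); [exact: bounded_continuous_max|rewrite e1 e2].
- by move=> c [].
- by move=> _ [_ [b [_ [M bM]] ->]]; exists M => x; exact: bM.
Qed.

End product_density.

(** * Euclidean norm, couplings and Wasserstein convergence *)

Section euclidean_norm.
Context (R : realType) (k : nat).
Implicit Types x y : 'rV[R]_k.

Lemma dotp_ge0 x : 0 <= dotp x x.
Proof. by apply: sumr_ge0 => j _; rewrite -expr2 sqr_ge0. Qed.

Lemma enorm_sqr x : enorm x ^+ 2 = dotp x x.
Proof. by rewrite /enorm sqr_sqrtr// dotp_ge0. Qed.

Lemma enorm0 : enorm (0 : 'rV[R]_k) = 0.
Proof. by rewrite /enorm /dotp big1 ?sqrtr0// => j _; rewrite mxE mul0r. Qed.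

Lemma sqr_entry_le x j : x 0 j ^+ 2 <= enorm x ^+ 2.
Proof.
rewrite enorm_sqr /dotp (bigD1 j)//= -expr2 lerDl.
by apply: sumr_ge0 => i _; rewrite -expr2 sqr_ge0.
Qed.

Lemma entry_le_enorm x j : `|x 0 j| <= enorm x.
Proof.
rewrite -(@ler_pXn2r _ 2)// ?nnegrE ?sqrtr_ge0// real_normK ?num_real//.
exact: sqr_entry_le.
Qed.

Lemma dotpZ (a : R) x y : dotp (a *: x) y = a * dotp x y.
Proof. by rewrite /dotp mulr_sumr; apply: eq_bigr => j _; rewrite mxE mulrA. Qed.

Lemma entryB x y j : (x - y) 0 j = x 0 j - y 0 j.
Proof. by rewrite !mxE. Qed.

Lemma entryZ (a : R) x j : (a *: x) 0 j = a * x 0 j.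
Proof. by rewrite mxE. Qed.

Lemma measurable_entry j : measurable_fun setT (fun x : 'rV[R]_k => x 0 j).
Proof. by apply: continuous_borel; exact: coord_continuous. Qed.

Lemma measurable_dotp d0 (T : measurableType d0) (f g : T -> 'rV[R]_k) :
  (forall j, measurable_fun setT (fun w => f w 0 j)) ->
  (forall j, measurable_fun setT (fun w => g w 0 j)) ->
  measurable_fun setT (fun w => dotp (f w) (g w)).
Proof.
by move=> mf mg; apply: measurable_sum => j; exact: measurable_funM.
Qed.

Lemma measurable_enorm2 d0 (T : measurableType d0) (f : T -> 'rV[R]_k) :
  (forall j, measurable_fun setT (fun w => f w 0 j)) ->
  measurable_fun setT (fun w => enorm (f w) ^+ 2).
Proof.
by move=> mf; under eq_fun do rewrite enorm_sqr; exact: measurable_dotp.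
Qed.

Lemma measurable_entryB d0 (T : measurableType d0) (f g : T -> 'rV[R]_k) j :
  measurable_fun setT f -> measurable_fun setT g ->
  measurable_fun setT (fun w => (f w - g w) 0 j).
Proof.
move=> mf mg; under eq_fun do rewrite !mxE.
by apply: measurable_funB; [exact: measurableT_comp (measurable_entry j) mf|
  exact: measurableT_comp (measurable_entry j) mg].
Qed.

End euclidean_norm.

Section wasserstein_convergence.
Context (R : realType).

Section couplings_from_maps.
Context (k : nat) (d0 : measure_display) (T : measurableType d0).
Context (P : probability T R) (Z Z' : T -> 'rV[R]_k).
Hypotheses (mZ : measurable_fun setT Z) (mZ' : measurable_fun setT Z').

Definition joint_law : probability ('rV[R]_k * 'rV[R]_k)%type R :=
  image_law P (measurable_fun_pair mZ mZ').

Lemma joint_lawP : has_law P (fun w => (Z w, Z' w)) joint_law.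
Proof. exact: image_lawP. Qed.

Lemma coupling_joint_law (mu nu : P2 R k) :
  has_law P Z mu -> has_law P Z' nu -> coupling mu nu joint_law.
Proof. by move=> lZ lZ' A mA; split; [rewrite lZ|rewrite lZ']. Qed.

Lemma cost_joint_law :
  cost joint_law = (\int[P]_w (enorm (Z w - Z' w) ^+ 2)%:E)%E.
Proof.
rewrite /cost (integral_law (measurable_fun_pair mZ mZ') joint_lawP)//.
apply/measurable_EFinP; apply: measurable_enorm2 => j; exact: measurable_entryB.
Qed.

End couplings_from_maps.

Lemma cost_ge0 k (g : probability ('rV[R]_k * 'rV[R]_k)%type R) : (0 <= cost g)%E.
Proof. by apply: integral_ge0 => p _; rewrite lee_fin sqr_ge0. Qed.

Lemma W2_sqr_le_cost k (mu nu : P2 R k) g :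
  coupling mu nu g -> (W2 mu nu ^+ 2 <= cost g)%E.
Proof.
move=> cg; rewrite /W2 poweR12_sqrt; last first.
  by apply/ereal_infP => _ [g' _ <-]; exact: cost_ge0.
rewrite sqr_sqrte; last by apply/ereal_infP => _ [g' _ <-]; exact: cost_ge0.
by apply: ereal_inf_lbound; exists g.
Qed.

Context (n : nat) (d : 'I_n -> nat).

(** Each coupling bounds the Wasserstein distance from above, so couplings with
    vanishing costs witness convergence. *)
Lemma P2bar_cvg_cost (rhok : nat -> P2bar R d) (rho : P2bar R d)
    (g : nat -> forall i, probability ('rV[R]_(d i) * 'rV[R]_(d i))%type R)
    (c : nat -> 'I_n -> R) :
  (forall k, couplings (rhok k) rho (g k)) ->
  (forall k i, cost (g k i) = (c k i)%:E) ->
  (forall i, c k i @[k --> \oo] --> 0) -> P2bar_cvg rhok rho.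
Proof.
move=> gk gc c0.
have c_ge0 k i : 0 <= c k i by rewrite -lee_fin -gc cost_ge0.
apply: (@squeeze_cvge _ _ _ _ (cst 0%E) _ (fun k => (Num.sqrt (\sum_i c k i))%:E)).
- apply: nearW => k; rewrite /W2bar poweR_ge0/=.
  rewrite -powR12_sqrt; last by apply: sumr_ge0 => i _; exact: c_ge0.
  rewrite -poweR_EFin; apply: gt0_ler_poweR => //.
  + by rewrite in_itv/= leey andbT sume_ge0// => i _; exact: sqre_ge0.
  + by rewrite in_itv/= leey andbT lee_fin sumr_ge0// => i _; exact: c_ge0.
  rewrite -sumEFin; apply: lee_sum => i _; rewrite -gc.
  by apply: W2_sqr_le_cost; exact: gk.
- exact: cvg_cst.
- apply: cvg_EFin; first exact: nearW.
  have : Num.sqrt (\sum_i c k i) @[k --> \oo] --> Num.sqrt (\sum_(i < n) 0 : R).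
    apply: continuous_cvg; first exact: sqrt_continuous.
    by apply: (cvg_big add_continuous) => i _; exact: c0.
  by rewrite big1// sqrtr0.
Qed.

Lemma P2bar_cvg_cst (rho : P2bar R d) : P2bar_cvg (fun=> rho) rho.
Proof.
have mid i := @measurable_id _ 'rV[R]_(d i) setT.
pose g i := joint_law (rho i) (mid i) (mid i).
apply: (@P2bar_cvg_cost _ _ (fun=> g) (fun _ _ => 0)).
- by move=> k i; exact: coupling_joint_law.
- move=> k i; rewrite cost_joint_law; under eq_integral do rewrite subrr enorm0 expr0n.
  exact: integral0.
- by move=> i; exact: cvg_cst.
Qed.

End wasserstein_convergence.

(** * Test functions and the uniform L2 bound of the velocities *)

Section slow_growth.
Context (R : realType) (r_ : nat -> R).
Hypothesis r_ge0 : forall j, 0 <= r_ j.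

Let h (j : nat) (r : R) := j.+1%:R^-1 * Num.min r (r_ j).

(** The function of the gliding hump argument: its [j]-th piece is capped by [r_ j],
    which keeps the growth below that of [r], and yet it dominates r / (j + 1) on
    the interval from 0 to [r_ j]. *)
Definition slow : R -> R := sup_family h.

Let h_le j r : h j r <= `|r|.
Proof.
have [r0|r0] := leP 0 r; last first.
  apply: le_trans (normr_ge0 _); rewrite /h pmulr_rle0// ge_min (ltW r0)//.
rewrite /h ger0_norm//; apply: (@le_trans _ _ (1 * Num.min r (r_ j))).
  by rewrite ler_wpM2r ?le_min ?r0 ?r_ge0// invf_le1 ?ler1n.
by rewrite mul1r ge_min lexx.
Qed.

Let h_bnd r : exists M, forall j, h j r <= M.
Proof. by exists `|r| => j; exact: h_le. Qed.

Lemma slow_lipschitz r s : `|slow r - slow s| <= `|r - s|.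
Proof.
apply: (@sup_family_lipschitz _ _ _ h (fun r s => `|r - s|) 0 _ h_bnd) => j x y.
rewrite /h -mulrBr normrM ger0_norm//.
apply: (@le_trans _ _ (1 * `|x - y|)); last by rewrite mul1r.
apply: ler_pM => //; first by rewrite invf_le1 ?ler1n.
have := ler_norm (x - y); have := ler_norm (y - x); rewrite (distrC y x) => p q.
have := normr_ge0 (x - y) => ?.
by rewrite /Num.min ler_norml; case: ltP => ?; case: ltP => ?; apply/andP; split; lra.
Qed.

Lemma slow_ge j r : j.+1%:R^-1 * Num.min r (r_ j) <= slow r.
Proof. exact: (sup_family_ge h_bnd j r). Qed.

Lemma slow_ge0 r : 0 <= r -> 0 <= slow r.
Proof.
move=> r0; apply: le_trans (slow_ge 0 r).
by rewrite mulr_ge0// le_min r0 r_ge0.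
Qed.

(** The pieces with 1 / (j + 1) <= e lie below [e * r]; finitely many remain, and
    each of them lies below its cap. *)
Lemma slow_growth (e : R) : 0 < e ->
  exists2 A, 0 <= A & forall r, 0 <= r -> slow r <= A + e * r.
Proof.
move=> e0; pose N := Num.truncn e^-1.
have eN : N.+1%:R^-1 <= e.
  by rewrite invf_ple ?posrE//; apply/ltW; exact: truncnS_gt.
exists (\sum_(j < N) r_ j); first by apply: sumr_ge0.
move=> r r0; apply: (sup_family_le 0) => j.
have er0 : 0 <= e * r by rewrite mulr_ge0// ltW.
have [jN|Nj] := ltnP j N.
  apply: (@le_trans _ _ (r_ j)).
    apply: (@le_trans _ _ (1 * Num.min r (r_ j))).
      by rewrite ler_wpM2r ?le_min ?r0 ?r_ge0// invf_le1 ?ler1n.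
    by rewrite mul1r ge_min lexx orbT.
  by rewrite (bigD1 (Ordinal jN))//= -addrA lerDl addr_ge0// sumr_ge0.
apply: (@le_trans _ _ (e * r)).
  apply: ler_pM => //; first by rewrite le_min r0 r_ge0.
    by apply: le_trans eN; rewrite lef_pV2 ?posrE// ler_nat ltnS.
  by rewrite ge_min lexx.
by rewrite lerDr sumr_ge0.
Qed.

End slow_growth.

Section test_functions.
Context (R : realType) (n : nat) (d : 'I_n -> nat).
Local Notation Rd := ('rV[R]_(\sum_(i < n) d i)).

Section entry.
Context (j : 'I_(\sum_(i < n) d i)).
(** A coordinate as a named function, to which the structure of a linear functional
    can be attached: weak convergence is tested on such functionals. *)
Definition entry (u : Rd) : R := u 0 j.
Let entry_linear : linear_for *%R entry.
Proof. by move=> a x y; rewrite /entry !mxE. Qed.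
HB.instance Definition _ := GRing.isLinear.Build R Rd R *%R entry entry_linear.

Lemma sw_cvg_entry (xk vk : nat -> Rd) (x v : Rd) : sw_cvg xk vk x v ->
  vk k 0 j @[k --> \oo] --> v 0 j.
Proof.
move=> [_ /(_ entry)]; apply; exists 1 => u.
by rewrite mul1r; exact: entry_le_enorm.
Qed.
End entry.

(** The test functions that the argument uses all have this shape: one coordinate of
    the velocity, combined with a bounded continuous function of the position. *)
Lemma C2sw_entry (j : 'I_(\sum_(i < n) d i)) (b : Rd -> R) (G : R -> R -> R) :
  bounded_continuous b ->
  (forall (a_ y_ : nat -> R) a y, a_ k @[k --> \oo] --> a ->
     y_ k @[k --> \oo] --> y -> G (a_ k) (y_ k) @[k --> \oo] --> G a y) ->
  (forall e, 0 < e -> exists2 A, 0 <= A &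
     forall x y, `|G (b x) y| <= A + e * y ^+ 2) ->
  C2sw (fun x u : Rd => G (b x) (u 0 j)).
Proof.
move=> [cb _] cG bG; split.
  move=> xk vk x v sw; apply: cG; last exact: sw_cvg_entry sw.
  by case: sw => cx _; exact: (cvg_comp _ _ cx (cb x)).
move=> e e0; have [A A0 AG] := bG e e0; exists A => // x u.
apply: le_trans (AG x (u 0 j)) _; apply: lerD.
  by rewrite ler_peMr// lerDl sqr_ge0.
by rewrite ler_wpM2l ?(ltW e0)// sqr_entry_le.
Qed.

End test_functions.

Section demicontinuity.
Context (R : realType) (n : nat) (d : 'I_n -> nat) (v : velocity_field R d).
Hypothesis hv : demicontinuous v.
Local Notation Rd := ('rV[R]_(\sum_(i < n) d i)).
Local Notation X := (dprod (fun i => 'rV[R]_(d i))).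

Definition vel (rho : P2bar R d) (j : 'I_(\sum_(i < n) d i)) (x : X) : R :=
  field_at v rho (concat x) 0 j.

Section along_a_sequence.
Context (rhok : nat -> P2bar R d) (rho : P2bar R d).
Hypothesis rhok_rho : P2bar_cvg rhok rho.

Lemma demicontinuous_test (j : 'I_(\sum_(i < n) d i)) (b : Rd -> R) (G : R -> R -> R) :
  bounded_continuous b ->
  (forall (a_ y_ : nat -> R) a y, a_ k @[k --> \oo] --> a ->
     y_ k @[k --> \oo] --> y -> G (a_ k) (y_ k) @[k --> \oo] --> G a y) ->
  (forall e, 0 < e -> exists2 A, 0 <= A &
     forall x y, `|G (b x) y| <= A + e * y ^+ 2) ->
  [/\ forall k, (prod_prob (rhok k)).-integrable setT
        (EFin \o (fun x => G (b (concat x)) (vel (rhok k) j x))),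
      (prod_prob rho).-integrable setT
        (EFin \o (fun x => G (b (concat x)) (vel rho j x))) &
      \int[prod_prob (rhok k)]_x G (b (concat x)) (vel (rhok k) j x) @[k --> \oo]
        --> \int[prod_prob rho]_x G (b (concat x)) (vel rho j x)].
Proof.
move=> Cb cG bG; have [i1 i2 c] := hv rhok_rho (C2sw_entry j Cb cG bG).
split => //; apply: fine_cvg; rewrite fineK//.
exact: (integrable_fin_num measurableT i2).
Qed.

Lemma integrable_vel j : (prod_prob rho).-integrable setT (EFin \o vel rho j).
Proof.
have [||_ + _] := @demicontinuous_test j (cst 0) (fun _ y => y) (bounded_continuous_cst _ 0).
- by [].
- move=> e e0; exists e^-1; first by rewrite invr_ge0 ltW.
  by move=> _ y; exact: norm_le_sqr.
- by [].
Qed.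

End along_a_sequence.

(** Measurability of the velocity comes from the integrability of test functions,
    applied to a constant sequence. *)
Lemma measurable_vel rho j : measurable_fun setT (vel rho j).
Proof.
have /integrable_vel/(_ j)/measurable_int := P2bar_cvg_cst rho.
by move/measurable_EFinP.
Qed.

Section uniform_bound.
Context (rhok : nat -> P2bar R d) (rho : P2bar R d).
Hypothesis rhok_rho : P2bar_cvg rhok rho.

(** Resonance. Were the second moments unbounded, one could find for every [m] an
    index [k] and a level [N] at which the integral of min (v^2, N) exceeds
    (m + 1)^2. The function [slow] built on these levels gives an admissible test
    function of v^2, whose integral at the index chosen for [m] exceeds m + 1;
    but demicontinuity makes these integrals converge, hence bounded. *)
Lemma vel_L2_bound j : exists C : R, forall k,
  (\int[prod_prob (rhok k)]_x (vel (rhok k) j x ^+ 2)%:E <= C%:E)%E.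
Proof.
apply: contrapT => /forallNP nC.
have mvel k : measurable_fun setT (fun x => vel (rhok k) j x ^+ 2).
  by apply: measurable_funX; exact: measurable_vel.
have mtr k (N : nat) : measurable_fun setT (fun x => Num.min (vel (rhok k) j x ^+ 2) N%:R).
  by apply: measurable_minr => //; exact: mvel.
have imin k (N : nat) : (prod_prob (rhok k)).-integrable setT
    (EFin \o (fun x => Num.min (vel (rhok k) j x ^+ 2) N%:R)).
  apply: (bounded_integrable (prod_prob (rhok k)) (M := N%:R) (mtr k N)) => x.
  have m0 : 0 <= Num.min (vel (rhok k) j x ^+ 2) N%:R by rewrite le_min sqr_ge0 ler0n.
  by rewrite (ger0_norm m0) ge_min lexx orbT.
have /choice[km hkm] : forall m : nat, exists kN : nat * nat,
    ((m.+1%:R ^+ 2)%:E < \int[prod_prob (rhok kN.1)]_x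
       (Num.min (vel (rhok kN.1) j x ^+ 2) kN.2%:R)%:E)%E.
  move=> m; have /existsNP[k /negP] := nC (m.+1%:R ^+ 2).
  rewrite -ltNge => hk.
  have cm : (\int[prod_prob (rhok k)]_x
       (Num.min (vel (rhok k) j x ^+ 2) N%:R)%:E)%E @[N --> \oo] -->
     (\int[prod_prob (rhok k)]_x (vel (rhok k) j x ^+ 2)%:E)%E.
    rewrite (_ : (\int[prod_prob (rhok k)]_x (vel (rhok k) j x ^+ 2)%:E)%E =
      (\int[prod_prob (rhok k)]_x
        limn (fun N => (Num.min (vel (rhok k) j x ^+ 2) N%:R)%:E))%E).
      apply: (@cvg_monotone_convergence _ _ _ (prod_prob (rhok k)) setT measurableT
        (fun (N : nat) x => (Num.min (vel (rhok k) j x ^+ 2) N%:R)%:E)).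
      - by move=> N; apply/measurable_EFinP; exact: mtr.
      - by move=> N x _; rewrite lee_fin le_min sqr_ge0/=.
      - move=> x _ p q pq; rewrite lee_fin le_min ge_min lexx/= ge_min.
        by rewrite ler_nat pq orbT.
    apply: eq_integral => x _; apply/esym/cvg_lim => //.
    apply: cvg_near_cst; near=> N; congr (_%:E); apply/min_idPl.
    by near: N; exact: nbhs_infty_ger.
  apply: contrapT => /forallNP nN; move: hk; apply/negP; rewrite -leNgt.
  rewrite -(cvg_lim _ cm)//; apply: lime_le; first by apply/cvg_ex; eexists; exact: cm.
  by apply: nearW => N; rewrite leNgt; apply/negP; exact: (nN (k, N)).
pose w := slow (fun m => (km m).2%:R : R).
have r0 m : 0 <= (km m).2%:R :> R by [].
have [i1 i2 c] : [/\ forall k, (prod_prob (rhok k)).-integrable setT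
        (EFin \o (fun x => w (vel (rhok k) j x ^+ 2))),
      (prod_prob rho).-integrable setT (EFin \o (fun x => w (vel rho j x ^+ 2))) &
      \int[prod_prob (rhok k)]_x w (vel (rhok k) j x ^+ 2) @[k --> \oo]
        --> \int[prod_prob rho]_x w (vel rho j x ^+ 2)].
  apply: (@demicontinuous_test rhok rho rhok_rho j (cst 0) (fun _ y => w (y ^+ 2))).
  - exact: bounded_continuous_cst.
  - move=> a_ y_ a y _ cy; have cw : continuous w.
      by apply: (@lipschitz_continuous _ _ _ _ 1) => r s; rewrite mul1r; exact: slow_lipschitz.
    have c2 : y_ k ^+ 2 @[k --> \oo] --> y ^+ 2 by exact: (cvgM cy cy).
    exact: (cvg_comp _ _ c2 (cw _)).
  - move=> e e0; have [A A0 wA] := slow_growth r0 e0.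
    by exists A => // _ y; rewrite ger0_norm ?slow_ge0 ?sqr_ge0// wA ?sqr_ge0.
have [B [_ hB]] := cvg_seq_bounded (cvgP _ c).
pose m := Num.trunc (B + 1).
have mB : B + 1 < m.+1%:R by exact: truncnS_gt.
have := hkm m; set k := (km m).1; set N := (km m).2 => lt_int.
have B1 : B < B + 1 by rewrite ltrDl.
have /= := hB (B + 1) B1 k I.
have wi : m.+1%:R^-1 * \int[prod_prob (rhok k)]_x Num.min (vel (rhok k) j x ^+ 2) N%:R
    <= \int[prod_prob (rhok k)]_x w (vel (rhok k) j x ^+ 2).
  rewrite -(RintegralZl _ measurableT (imin k N)).
  apply: (@le_Rintegral _ _ _ (prod_prob (rhok k)) setT _ _ measurableT) => [||x _].
  - exact: (integrableZl measurableT _ (imin k N)).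
  - exact: i1.
  - exact: (slow_ge r0).
have lt_int' : m.+1%:R < m.+1%:R^-1 *
    \int[prod_prob (rhok k)]_x Num.min (vel (rhok k) j x ^+ 2) N%:R.
  rewrite ltr_pdivlMl// -expr2 -lte_fin fineK//.
  exact: (integrable_fin_num measurableT (imin k N)).
have := ler_norm (\int[prod_prob (rhok k)]_x w (vel (rhok k) j x ^+ 2)).
move=> h1 h2; have := lt_le_trans lt_int' (le_trans wi (le_trans h1 h2)).
by rewrite ltNge (ltW mB).
Unshelve. all: by end_near. Qed.

End uniform_bound.

End demicontinuity.

(** * Convergence of the velocities in L1 *)

Section convergence_of_velocities.
Context (R : realType) (n : nat) (d : 'I_n -> nat) (v : velocity_field R d).
Hypothesis hv : demicontinuous v.
Local Notation Rd := ('rV[R]_(\sum_(i < n) d i)).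
Local Notation X := (dprod (fun i => 'rV[R]_(d i))).
Context (dO : measure_display) (O : measurableType dO) (P : probability O R).

Section one_law.
Context (rho : P2bar R d) (F : O -> X).
Hypotheses (mF : measurable_fun setT F) (lF : has_law P F (prod_prob rho)).

Lemma measurable_vel_comp j : measurable_fun setT (fun w => vel v rho j (F w)).
Proof. exact: measurableT_comp (measurable_vel hv rho j) mF. Qed.

Lemma vel_sqint_bound j (C : R) :
  (\int[prod_prob rho]_x (vel v rho j x ^+ 2)%:E <= C%:E)%E ->
  sqint P (fun w => vel v rho j (F w)) /\
  \int[P]_w (vel v rho j (F w) ^+ 2) <= C.
Proof.
have mv2 : measurable_fun setT (fun x => vel v rho j x ^+ 2).
  by apply: measurable_funX; exact: measurable_vel.
have mv2E : measurable_fun setT (fun x => (vel v rho j x ^+ 2)%:E).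
  exact/measurable_EFinP.
rewrite (integral_law mF lF mv2E) => hC.
have iv : P.-integrable setT (EFin \o (fun w => vel v rho j (F w) ^+ 2)).
  apply/integrableP; split.
    by apply/measurable_EFinP; apply: measurable_funX; exact: measurable_vel_comp.
  apply: le_lt_trans (ltry C).
  by under eq_integral do rewrite /= ger0_norm ?sqr_ge0//.
split; first by split => //; exact: measurable_vel_comp.
by rewrite -lee_fin fineK//; exact: (integrable_fin_num measurableT iv).
Qed.

Lemma sqint_vel j : sqint P (fun w => vel v rho j (F w)).
Proof.
have [C hC] := vel_L2_bound hv (P2bar_cvg_cst rho) j.
by have [] := vel_sqint_bound (hC 0%N).
Qed.

End one_law.

Context (rhok : nat -> P2bar R d) (rho : P2bar R d).
Context (F_ : nat -> O -> X) (F : O -> X).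
Hypothesis rhok_rho : P2bar_cvg rhok rho.
Hypotheses (mF_ : forall k, measurable_fun setT (F_ k)) (mF : measurable_fun setT F).
Hypothesis lF_ : forall k, has_law P (F_ k) (prod_prob (rhok k)).
Hypothesis lF : has_law P F (prod_prob rho).
Hypothesis F_cvg : forall w, concat (F_ k w) @[k --> \oo] --> concat (F w).

(** Convergence of laws improves to convergence in L1 because the limit velocity is a
    function of the position. It is close in L1 to a bounded continuous [b], the
    test function |v - b(x)| shows that the velocities along the sequence are
    eventually as close to [b], and [b] itself is evaluated at convergent positions. *)
Lemma vel_cvg_L1 j :
  \int[P]_w `|vel v (rhok k) j (F_ k w) - vel v rho j (F w)| @[k --> \oo] --> 0.
Proof.
apply/cvgrPdist_le => /= e e0.
have e4 : 0 < e / 4 by rewrite divr_gt0.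
have iv := integrable_vel hv (P2bar_cvg_cst rho) j.
have [b [[cb [M bM]] mb hb]] := approximable_on_product e4 iv.
have bc : bounded_continuous b by split => //; exists M.
have M0 : 0 <= M by apply: le_trans (normr_ge0 (b 0)) (bM 0).
have [i1 i2 c] : [/\ forall k, (prod_prob (rhok k)).-integrable setT
        (EFin \o (fun x => `|vel v (rhok k) j x - b (concat x)|)),
      (prod_prob rho).-integrable setT (EFin \o (fun x => `|vel v rho j x - b (concat x)|)) &
      \int[prod_prob (rhok k)]_x `|vel v (rhok k) j x - b (concat x)| @[k --> \oo]
        --> \int[prod_prob rho]_x `|vel v rho j x - b (concat x)|].
  apply: (@demicontinuous_test _ _ _ _ hv _ _ rhok_rho j b (fun a y => `|y - a|)) => //.
  - by move=> a_ y_ a y ca cy; apply: cvg_norm; exact: cvgB.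
  - move=> q q0; exists (M + q^-1); first by rewrite addr_ge0// invr_ge0 ltW.
    move=> x y; rewrite normr_id (le_trans (ler_normB _ _))//.
    suff : `|y| <= q^-1 + q * y ^+ 2 by have := bM x; lra.
    exact: norm_le_sqr.
pose B_ k w := b (concat (F_ k w)); pose B w := b (concat (F w)).
have mB_ k : measurable_fun setT (B_ k) by exact: measurableT_comp mb (mF_ k).
have mB : measurable_fun setT B by exact: measurableT_comp mb mF.
have iB_ k : P.-integrable setT (EFin \o B_ k).
  by apply: (bounded_integrable P (M := M) (mB_ k)) => w; exact: bM.
have iB : P.-integrable setT (EFin \o B).
  by apply: (bounded_integrable P (M := M) mB) => w; exact: bM.
have iV_ k : P.-integrable setT (EFin \o (fun w => vel v (rhok k) j (F_ k w))).
  exact: sqint_integrable (sqint_vel (mF_ k) (@lF_ k) j).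
have iV : P.-integrable setT (EFin \o (fun w => vel v rho j (F w))).
  exact: sqint_integrable (sqint_vel mF lF j).
have cB : \int[P]_w `|B_ k w - B w| @[k --> \oo] --> \int[P]__ (0 : R).
  apply: (@cvg_Rintegral_dominated _ _ _ P _ _ (cst (M + M))).
  - by move=> k; apply: measurableT_comp => //; exact: measurable_funB.
  - move=> w; rewrite -(@normr0 _ R) -(subrr (B w)).
    apply: cvg_norm; apply: cvgB; last exact: cvg_cst.
    have h : b (concat (F_ k w)) @[k --> \oo] --> b (concat (F w)).
      exact: (cvg_comp _ _ (@F_cvg w) (cb (concat (F w)))).
    exact: h.
  - exact: finite_measure_integrable_cst.
  - move=> k w; rewrite normr_id.
    exact: (le_trans (ler_normB _ _) (lerD (bM _) (bM _))).
rewrite Rintegral_cst// mul0r in cB.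
move/cvgrPdist_le : cB => /(_ _ e4) cB.
move/cvgrPdist_le : c => /(_ _ e4) c.
have mvb : measurable_fun setT (fun x => `|vel v rho j x - b (concat x)|).
  apply: measurableT_comp => //; apply: measurable_funB => //; exact: measurable_vel.
have mvbk k : measurable_fun setT (fun x => `|vel v (rhok k) j x - b (concat x)|).
  apply: measurableT_comp => //; apply: measurable_funB => //; exact: measurable_vel.
near=> k.
have ck : `|\int[prod_prob rho]_x `|vel v rho j x - b (concat x)| -
   \int[prod_prob (rhok k)]_x `|vel v (rhok k) j x - b (concat x)| | <= e / 4.
  by near: k; exact: c.
have cBk : `|0 - \int[P]_w `|B_ k w - B w| | <= e / 4 by near: k; exact: cB.
rewrite (Rintegral_law mF lF mvb) in ck hb.
rewrite (Rintegral_law (mF_ k) (@lF_ k) (mvbk k)) in ck.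
rewrite sub0r normrN (ger0_norm (Rintegral_ge0 _ _)) in cBk; last by [].
rewrite sub0r normrN (ger0_norm (Rintegral_ge0 _ _)); last by [].
move: ck; rewrite ler_norml => /andP[ck _].
have d1 := integrable_dist (iV_ k) (iB_ k).
have d2 := integrable_dist (iB_ k) iB.
have d3 := integrable_dist iV iB.
have d12 := integrable_addr d1 d2.
have d123 := integrable_addr d12 d3.
apply: (@le_trans _ _ (\int[P]_w (`|vel v (rhok k) j (F_ k w) - B_ k w| +
   `|B_ k w - B w| + `|vel v rho j (F w) - B w|))).
  apply: (@le_Rintegral _ _ _ P setT _ _ measurableT) => //.
    exact: integrable_dist (iV_ k) iV.
  move=> w _; rewrite (distrC (vel v rho j (F w))).
  have -> : vel v (rhok k) j (F_ k w) - vel v rho j (F w) =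
    (vel v (rhok k) j (F_ k w) - B_ k w) + (B_ k w - B w) + (B w - vel v rho j (F w)) by ring.
  by rewrite (le_trans (ler_normD _ _))// lerD2r ler_normD.
rewrite RintegralD// RintegralD//.
move: ck cBk hb; rewrite /B_ /B; lra.
Unshelve. all: by end_near. Qed.

Lemma cvg_Rintegral_mul_vel j (Y_ : nat -> O -> R) (Y : O -> R) :
  (forall k, sqint P (Y_ k)) -> sqint P Y ->
  \int[P]_w ((Y_ k w - Y w) ^+ 2) @[k --> \oo] --> 0 ->
  \int[P]_w (Y_ k w * vel v (rhok k) j (F_ k w)) @[k --> \oo] -->
  \int[P]_w (Y w * vel v rho j (F w)).
Proof.
move=> sY_ sY cY.
have [C hC] := vel_L2_bound hv rhok_rho j.
have [C' hC'] := vel_L2_bound hv (P2bar_cvg_cst rho) j.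
have bk k := vel_sqint_bound (mF_ k) (@lF_ k) (hC k).
have b := vel_sqint_bound mF lF (hC' 0%N).
apply: (@cvg_Rintegral_mul _ _ _ P Y_ _ Y _ (Num.max C C')) => //.
- by move=> k; case: (bk k).
- by case: b.
- by move=> k; rewrite le_max; case: (bk k) => _ ->.
- by rewrite le_max; case: b => _ ->; rewrite orbT.
- exact: vel_cvg_L1.
Qed.

End convergence_of_velocities.

(** * Measurable maps of finite range and quantization *)

Section row_vectors.
Context (R : realType) (k : nat).
Local Notation V := ('rV[R]_k).

Lemma cvg_row (u_ : nat -> V) (u : V) :
  (forall j, u_ N 0 j @[N --> \oo] --> u 0 j) -> u_ N @[N --> \oo] --> u.
Proof.
move=> cu; apply/cvgrPdist_le => /= e e0.
have : \forall N \near \oo, forall j : 'I_k, `|u 0 j - u_ N 0 j| <= e.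
  apply: filter_forall => j.
  by have /cvgrPdist_le/(_ _ e0) := @cu j.
apply: filterS => N uN; rewrite -[leLHS]/(mx_norm _) mx_normrE.
apply: bigmax_le => [|[a b] _]; first exact: ltW.
by rewrite ord1 !mxE.
Qed.

Lemma measurable_row1 (y : V) : measurable [set y].
Proof.
rewrite (_ : [set y] = \bigcap_(j in [set: 'I_k]) ((fun x : V => x 0 j) @^-1` [set y 0 j])).
  apply: fin_bigcap_measurable => // j _.
  by have := @measurable_entry R k j measurableT _ (measurable_set1 (y 0 j)); rewrite setTI.
by apply/seteqP; split => x /= => [-> //|xy]; apply/rowP => j; exact: xy.
Qed.

Lemma measurable_finite_rows (A : set V) : finite_set A -> measurable A.
Proof.
move=> fA; rewrite (_ : A = \bigcup_(y in A) [set y]); last first.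
  by apply/seteqP; split => [y Ay|_ [y Ay ->]//]; exists y.
by apply: fin_bigcup_measurable => // y _; exact: measurable_row1.
Qed.

Lemma measurable_finite_range d0 (T : measurableType d0) (f : T -> V) :
  finite_set (range f) -> (forall j, measurable_fun setT (fun w => f w 0 j)) ->
  measurable_fun setT f.
Proof.
move=> ff mf _ A mA; rewrite setTI.
rewrite (_ : f @^-1` A = \bigcup_(y in range f `&` A)
  \bigcap_(j in [set: 'I_k]) ((fun w => f w 0 j) @^-1` [set y 0 j])).
  apply: fin_bigcup_measurable => [|y _].
    by apply: sub_finite_set ff => y [].
  apply: fin_bigcap_measurable => // j _.
  by have := mf j measurableT _ (measurable_set1 (y 0 j)); rewrite setTI.
apply/seteqP; split => w /=.
  by move=> Afw; exists (f w) => //; split => //; exists w.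
move=> [y [_ Ay] fy]; suff -> : f w = y by [].
by apply/rowP => j; exact: fy.
Qed.

End row_vectors.

Section quantization.
Context (R : realType).
Import HBNNSimple.

(** The difference of the monotone approximations, by simple functions, of the
    positive and the negative part; monotonicity gives the bound by [|t|]. *)
Lemma exists_quantizer : exists q : nat -> R -> R,
  [/\ forall N, measurable_fun setT (q N), forall N, finite_set (range (q N)),
      forall t, q N t @[N --> \oo] --> t & forall N t, `|q N t| <= `|t|].
Proof.
have mp : measurable_fun setT (fun t : R => (Num.max 0 t)%:E).
  by apply/measurable_EFinP; exact: measurable_maxr.
have mm : measurable_fun setT (fun t : R => (Num.max 0 (- t))%:E).
  by apply/measurable_EFinP; apply: measurable_maxr => //; exact: measurableT_comp.
pose p := nnsfun_approx measurableT mp; pose m := nnsfun_approx measurableT mm.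
have cp t : p N t @[N --> \oo] --> Num.max 0 t.
  have := @cvg_nnsfun_approx _ _ _ setT measurableT _ mp _ t I.
  by move=> /(_ _)/fine_cvg; apply => x _; rewrite lee_fin le_max lexx.
have cm t : m N t @[N --> \oo] --> Num.max 0 (- t).
  have := @cvg_nnsfun_approx _ _ _ setT measurableT _ mm _ t I.
  by move=> /(_ _)/fine_cvg; apply => x _; rewrite lee_fin le_max lexx.
have lp N t : p N t <= Num.max 0 t.
  rewrite -(cvg_lim _ (cp t))//; apply: nondecreasing_cvgn_le.
    by move=> a b ab; have /lefP := nd_nnsfun_approx measurableT mp ab; exact.
  by apply/cvg_ex; eexists; exact: cp.
have lm N t : m N t <= Num.max 0 (- t).
  rewrite -(cvg_lim _ (cm t))//; apply: nondecreasing_cvgn_le.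
    by move=> a b ab; have /lefP := nd_nnsfun_approx measurableT mm ab; exact.
  by apply/cvg_ex; eexists; exact: cm.
exists (fun N t => p N t - m N t); split.
- by move=> N; exact: measurable_funB.
- move=> N; apply: (@sub_finite_set _ _
    ((fun ab => ab.1 - ab.2) @` (range (p N) `*` range (m N)))).
    by move=> _ [t _ <-]; exists (p N t, m N t) => //; split; exists t.
  by apply: finite_image; apply: finite_setX; exact: fimfunP.
- move=> t; rewrite [X in _ --> X](_ : t = Num.max 0 t - Num.max 0 (- t)).
    by apply: cvgB; [exact: cp|exact: cm].
  by rewrite /Num.max oppr_gt0; case: ltgtP => [||<-]; rewrite ?subr0 ?sub0r ?opprK.
- move=> N t; have := lp N t; have := lm N t.
  have : 0 <= p N t by []. have : 0 <= m N t by [].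
  rewrite ler_norml /Num.max oppr_gt0; case: ltgtP => t0 h1 h2 h3 h4.
  + by rewrite ltr0_norm//; apply/andP; split; lra.
  + by rewrite gtr0_norm//; apply/andP; split; lra.
  + have -> : `|t| = 0 by rewrite t0 normr0.
    by apply/andP; split; lra.
Qed.

Lemma finite_rows (k : nat) (A : set R) : finite_set A ->
  finite_set [set x : 'rV[R]_k | forall j, A (x 0 j)].
Proof.
move=> /finite_seqP[s ->].
pose row (f : {ffun 'I_k -> 'I_(size s).+1}) : 'rV[R]_k := \row_j nth 0 s (f j).
apply: (@sub_finite_set _ _ (row @` setT)); last exact/finite_image/finite_finset.
move=> x /= sx; exists [ffun j => inord (index (x 0 j) s)] => //.
by apply/rowP => j; rewrite mxE ffunE inordK ?ltnS ?index_size ?nth_index//.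
Qed.

End quantization.

(** * Local optimality along segments *)

Section nearest_point_coupling.
Context (R : realType) (k : nat) (d0 : measure_display) (T : measurableType d0).
Context (P : probability T R) (Z Z' : T -> 'rV[R]_k) (mu nu : P2 R k).
Hypotheses (mZ : measurable_fun setT Z) (mZ' : measurable_fun setT Z').
Hypotheses (fZ : finite_set (range Z)).
Hypotheses (lZ : has_law P Z mu) (lZ' : has_law P Z' nu).
Hypothesis nearest : forall w w0, enorm (Z w - Z' w) ^+ 2 <= enorm (Z w0 - Z' w) ^+ 2.

(** Any coupling of [mu] and [nu] costs at least the integral with respect to [nu] of
    the squared distance to the finitely many points charged by [mu], and this
    one costs exactly that. *)
Lemma nearest_point_optimal : optimal_coupling mu nu (joint_law P mZ mZ').
Proof.
split=> [|g' cg']; first exact: coupling_joint_law.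
have /finite_seqP[s sE] := fZ.
(* the squared distance to the range of [Z] *)
pose D y := \big[Num.min/enorm (Z point - y) ^+ 2]_(z <- s) enorm (z - y) ^+ 2.
have mD : measurable_fun setT D.
  rewrite /D; elim: s {sE D} => [|z s ih].
    under eq_fun do rewrite big_nil.
    by apply: measurable_enorm2 => j; apply: measurable_entryB.
  under eq_fun do rewrite big_cons.
  apply: measurable_minr => //.
  by apply: measurable_enorm2 => j; exact: measurable_entryB.
have D0 y : 0 <= D y by rewrite /D; apply: le_bigmin => *; exact: sqr_ge0.
have Dle z y : range Z z -> D y <= enorm (z - y) ^+ 2.
  rewrite sE /= => zs; rewrite /D.
  exact: (ge_bigmin_seq _ z xpredT (fun z => enorm (z - y) ^+ 2) zs isT).
have DZ' w : enorm (Z w - Z' w) ^+ 2 <= D (Z' w).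
  rewrite /D big_seq; apply: le_bigmin => [|z zs]; first exact: nearest.
  have [w0 _ <-] : range Z z by rewrite sE.
  exact: nearest.
have mDE : measurable_fun setT (EFin \o D) by exact/measurable_EFinP.
have lsnd : has_law g' snd nu by move=> A mA; rewrite -(cg' A mA).2.
rewrite cost_joint_law; apply: (@le_trans _ _ (\int[P]_w (D (Z' w))%:E)%E).
  apply: ge0_le_integral => //.
  - by move=> w _; rewrite lee_fin sqr_ge0.
  - apply/measurable_EFinP; apply: measurable_enorm2 => j; exact: measurable_entryB.
  - exact: measurableT_comp mDE mZ'.
  - by move=> w _; rewrite lee_fin.
rewrite -(ge0_integral_law mZ' lZ' mDE) => [|y]; last by rewrite lee_fin.
rewrite (ge0_integral_law measurable_snd lsnd mDE) => [|y]; last by rewrite lee_fin.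
apply: ae_ge0_le_integral => //.
- by move=> p _; rewrite lee_fin.
- exact: measurableT_comp mDE measurable_snd.
- by move=> p _; rewrite lee_fin sqr_ge0.
- by apply/measurable_EFinP; apply: measurable_enorm2 => j; exact: measurable_entryB.
(* the first marginal charges the range of [Z] only *)
exists (fst @^-1` (~` range Z)); split.
- rewrite -[X in measurable X]setTI; apply: measurable_fst => //.
  exact: measurableC (measurable_finite_rows fZ).
- have mC := measurableC (measurable_finite_rows fZ).
  apply: (eq_trans (cg' _ mC).1); rewrite (lZ mC) (_ : _ @^-1` _ = set0) ?measure0//.
  by apply/seteqP; split => w //= nw; apply: nw; exists w.
- move=> p /= np Zp; apply: np => _; rewrite lee_fin.
  exact: Dle.
Qed.

End nearest_point_coupling.

Section segments.
Context (R : realType) (k : nat).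
Local Notation V := ('rV[R]_k).
Implicit Types p q : V * V.

Definition segment (t : R) (p : V * V) : V := (1 - t) *: p.1 + t *: p.2.

Lemma segmentB s t p : segment t p - segment s p = (t - s) *: (p.2 - p.1).
Proof. by apply/rowP => j; rewrite /segment !mxE; ring. Qed.

Lemma dotp_eq0 (x : V) : dotp x x = 0 -> x = 0.
Proof.
move=> x0; apply/rowP => j; rewrite mxE; apply/eqP.
rewrite -sqrf_eq0 eq_le sqr_ge0 andbT -x0.
by rewrite -enorm_sqr sqr_entry_le.
Qed.

(** With [a] the gap between the two moving points at time [t], the terms of second
    order in [t - s] cancel and the squared distances differ by
    |a|^2 + 2 (t - s) <a, D>. This vanishes if [a] does, and otherwise it is
    positive for [s] close to [t]. *)
Lemma near_nearest (t : R) p q : \forall s \near t,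
  enorm (segment t p - segment s p) ^+ 2 <= enorm (segment t q - segment s p) ^+ 2.
Proof.
pose a := segment t q - segment t p; pose D := p.2 - p.1.
have E s : enorm (segment t q - segment s p) ^+ 2 -
    enorm (segment t p - segment s p) ^+ 2 = dotp a a + 2 * (t - s) * dotp a D.
  have -> : segment t q - segment s p = a + (t - s) *: D.
    by rewrite -segmentB addrA subrK.
  rewrite segmentB -/D !enorm_sqr /dotp -sumrB mulr_sumr -big_split/=.
  move: a D => a D; apply: eq_bigr => j _; rewrite !mxE; ring.
have [a0|a0] := eqVneq (dotp a a) 0.
  near=> s; rewrite -subr_ge0 E a0 (dotp_eq0 a0).
  by rewrite [dotp 0 D]big1 ?mulr0 ?addr0// => j _; rewrite mxE mul0r.
have ap : 0 < dotp a a by rewrite lt_neqAle eq_sym a0 dotp_ge0.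
pose e := dotp a a / (2 * `|dotp a D| + 1).
have m0 : 0 < 2 * `|dotp a D| + 1 by rewrite ltr_wpDl// mulr_ge0.
have e0 : 0 < e by rewrite divr_gt0.
near=> s.
rewrite -subr_ge0 E.
have ts : `|t - s| <= e by near: s; apply: cvgr_dist_le => //; exact: cvg_id.
have : `|2 * (t - s) * dotp a D| <= dotp a a.
  rewrite !normrM (ger0_norm (_ : 0 <= 2))// mulrAC mulrC.
  apply: (@le_trans _ _ (e * (2 * `|dotp a D| + 1))).
    by apply: ler_pM => //; rewrite lerDl.
  by rewrite /e divfK// gt_eqF.
rewrite ler_norml => /andP[h _]; lra.
Unshelve. all: by end_near. Qed.

Lemma near_all_seq (I : eqType) (F : set_system R) (FF : Filter F) (s : seq I)
    (Q : I -> R -> Prop) :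
  (forall i, i \in s -> \forall x \near F, Q i x) ->
  \forall x \near F, forall i, i \in s -> Q i x.
Proof.
elim: s => [|i s ih] h; first by apply: nearW.
have h1 := h i (mem_head _ _).
have h2 : \forall x \near F, forall j, j \in s -> Q j x.
  by apply: ih => j js; apply: h; rewrite in_cons js orbT.
near=> x => j; rewrite in_cons => /orP[/eqP ->|js]; first by near: x.
by apply: (near h2 x).
Unshelve. all: by end_near. Qed.

Lemma near_nearest_finite (t : R) (S : set (V * V)) : finite_set S ->
  \forall s \near t, forall p q, S p -> S q ->
  enorm (segment t p - segment s p) ^+ 2 <= enorm (segment t q - segment s p) ^+ 2.
Proof.
move=> /finite_seqP[l ->].
pose Q p q s := enorm (segment t p - segment s p) ^+ 2 <=
  enorm (segment t q - segment s p) ^+ 2.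
have h : \forall s \near t, forall p, p \in l -> forall q, q \in l -> Q p q s.
  apply: (@near_all_seq _ (nbhs t) _ l (fun p s => forall q, q \in l -> Q p q s)) => p _.
  apply: (@near_all_seq _ (nbhs t) _ l (fun q s => Q p q s)) => q _; exact: near_nearest.
by apply: filterS h => s h p q /= pl ql; exact: h.
Qed.

End segments.

Section local_monotonicity.
Context (R : realType) (psi : R -> R).
Hypothesis loc : forall t, \forall s \near t, (psi s - psi t) * (s - t) <= 0.

(** Let [c] be the supremum of the times at which [psi] is at most [psi 0]. Comparing
    at [c] with earlier times shows that [c] is such a time, and comparing with
    later times shows that [c] cannot be smaller than 1. *)
Lemma locally_decreasing01 : psi 1 <= psi 0.
Proof.
have loc_ball t : exists2 e, 0 < e & forall s, `|t - s| < e -> (psi s - psi t) * (s - t) <= 0.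
  by have /nbhs_ballP[e e0 h] := loc t; exists e => // s ts; exact: h.
pose A := [set t | 0 <= t <= 1 /\ psi t <= psi 0].
have A0 : A 0 by split => //; rewrite lexx ler01.
have ubA : has_ubound A by exists 1 => t [/andP[]].
have supA : has_sup A by split => //; exists 0.
pose c := sup A.
have c0 : 0 <= c by exact: ub_le_sup.
have c1 : c <= 1 by apply: ge_sup; [exists 0|move=> t [/andP[]]].
have [e e0 he] := loc_ball c.
have pc : psi c <= psi 0.
  have [t [t01 pt] ct] := sup_adherent e0 supA.
  have tc : t <= c by exact: ub_le_sup.
  have [tcE|tc'] := eqVneq t c; first by rewrite -tcE.
  have ltc : t < c by rewrite lt_neqAle tc'.
  have := he t; rewrite ger0_norm ?subr_ge0// => /(_ _); rewrite -/c in ct.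
  have -> : (c - t < e) = true by apply/idP; lra.
  by move=> /(_ isT); rewrite nmulr_lle0 ?subr_lt0// subr_ge0 => h; exact: le_trans h pt.
have [cE|nc1] := eqVneq c 1; first by rewrite -cE.
have ltc1 : c < 1 by rewrite lt_neqAle nc1.
pose s := Num.min 1 (c + e / 2).
have cs : c < s by rewrite lt_min ltc1/= ltrDl divr_gt0.
have s1 : s <= 1 by rewrite ge_min lexx.
have se : s <= c + e / 2 by rewrite ge_min lexx orbT.
have := he s; rewrite distrC gtr0_norm ?subr_gt0// => /(_ _).
have -> : (s - c < e) = true by apply/idP; lra.
move=> /(_ isT); rewrite pmulr_lle0 ?subr_gt0// subr_le0 => h.
have : s <= c by apply: ub_le_sup => //; split; [rewrite s1 andbT; lra|exact: le_trans h pc].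
by rewrite leNgt cs.
Qed.

End local_monotonicity.

(** * Square-integrable random vectors *)

Section integrals_of_rows.
Context (R : realType) (k : nat) (d0 : measure_display) (O : measurableType d0).
Context (P : probability O R).
Implicit Types f g : O -> 'rV[R]_k.

Lemma Rintegral_sum_seq (I : Type) (s : seq I) (h : I -> O -> R) :
  (forall i, P.-integrable setT (EFin \o h i)) ->
  P.-integrable setT (EFin \o (fun w => \sum_(i <- s) h i w)) /\
  \int[P]_w (\sum_(i <- s) h i w) = \sum_(i <- s) \int[P]_w h i w.
Proof.
move=> ih; elim: s => [|i s [is_ IH]].
  under [X in EFin \o X]eq_fun do rewrite big_nil.
  under [X in Rintegral _ _ X]eq_fun do rewrite big_nil.
  rewrite Rintegral_cst// mul0r big_nil; split => //.
  exact: finite_measure_integrable_cst.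
under [X in EFin \o X]eq_fun do rewrite big_cons.
under [X in Rintegral _ _ X]eq_fun do rewrite big_cons.
by rewrite RintegralD// IH big_cons; split => //; exact: integrable_addr.
Qed.

Lemma integrable_dotp f g : (forall j, sqint P (fun w => f w 0 j)) ->
  (forall j, sqint P (fun w => g w 0 j)) ->
  P.-integrable setT (EFin \o (fun w => dotp (f w) (g w))).
Proof. by move=> sf sg; apply: (Rintegral_sum_seq _ _).1 => j; exact: sqint_mul. Qed.

Lemma Rintegral_dotp f g : (forall j, sqint P (fun w => f w 0 j)) ->
  (forall j, sqint P (fun w => g w 0 j)) ->
  \int[P]_w dotp (f w) (g w) = \sum_j \int[P]_w (f w 0 j * g w 0 j).
Proof. by move=> sf sg; apply: (Rintegral_sum_seq _ _).2 => j; exact: sqint_mul. Qed.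

Lemma integrable_enorm2 f : (forall j, sqint P (fun w => f w 0 j)) ->
  P.-integrable setT (EFin \o (fun w => enorm (f w) ^+ 2)).
Proof.
by move=> sf; under [X in EFin \o X]eq_fun do rewrite enorm_sqr; exact: integrable_dotp.
Qed.

Lemma Rintegral_enorm2 f : (forall j, sqint P (fun w => f w 0 j)) ->
  \int[P]_w (enorm (f w) ^+ 2) = \sum_j \int[P]_w (f w 0 j ^+ 2).
Proof.
move=> sf; under [X in Rintegral _ _ X]eq_fun do rewrite enorm_sqr.
by rewrite Rintegral_dotp.
Qed.

Lemma integral_enorm2E f : (forall j, sqint P (fun w => f w 0 j)) ->
  (\int[P]_w (enorm (f w) ^+ 2)%:E)%E = (\int[P]_w (enorm (f w) ^+ 2))%:E.
Proof.
move=> sf; rewrite fineK//.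
exact: (integrable_fin_num measurableT (integrable_enorm2 sf)).
Qed.

Lemma sqint_entryB f g j : sqint P (fun w => f w 0 j) -> sqint P (fun w => g w 0 j) ->
  sqint P (fun w => (f w - g w) 0 j).
Proof. by move=> sf sg; under eq_fun do rewrite !mxE; exact: sqintB. Qed.

Lemma cvg_sqr_dominated (f_ : nat -> O -> R) (f h : O -> R) :
  (forall N, measurable_fun setT (f_ N)) -> sqint P h ->
  (forall w, f_ N w @[N --> \oo] --> f w) -> (forall N w, `|f_ N w| <= h w) ->
  [/\ forall N, sqint P (f_ N), sqint P f,
      \int[P]_w ((f_ N w - f w) ^+ 2) @[N --> \oo] --> 0 &
      \int[P]_w (f_ N w ^+ 2) @[N --> \oo] --> \int[P]_w (f w ^+ 2)].
Proof.
move=> mf sh cf fh.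
have mlim : measurable_fun setT f.
  by apply: (@measurable_fun_cvg _ _ R setT f_ f) => // w _; exact: cf.
have fh' w : `|f w| <= h w by exact: (norm_cvg_le (@cf w) (fun N => fh N w)).
have h0 w : 0 <= h w by exact: le_trans (fh 0%N w).
have sf_ N : sqint P (f_ N) by apply: sqint_le sh _ => // w; rewrite (ger0_norm (h0 w)).
have sf : sqint P f by apply: sqint_le sh _ => // w; rewrite (ger0_norm (h0 w)).
have sqr_le (a b : R) : `|a| <= b -> a ^+ 2 <= b ^+ 2.
  move=> ab; rewrite -[a ^+ 2]real_normK ?num_real// lerXn2r ?nnegrE//.
  exact: le_trans ab.
split => //.
- suff : \int[P]_w ((f_ N w - f w) ^+ 2) @[N --> \oo] --> \int[P]__ (0 : R).
    by rewrite Rintegral_cst// mul0r.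
  apply: (@cvg_Rintegral_dominated _ _ _ P _ _ (fun w => 4 * h w ^+ 2)).
  + by move=> N; apply: measurable_funX; exact: measurable_funB.
  + move=> w; have c0 : f_ N w - f w @[N --> \oo] --> f w - f w.
      by apply: cvgB; [exact: cf|exact: cvg_cst].
    rewrite subrr in c0; have := cvgM c0 c0; rewrite mulr0; exact.
  + exact: (integrableZl measurableT 4 sh.2).
  + move=> N w; rewrite ger0_norm ?sqr_ge0//.
    have -> : 4 * h w ^+ 2 = (h w + h w) ^+ 2 by ring.
    by apply: sqr_le; rewrite (le_trans (ler_normB _ _))// lerD.
- apply: (@cvg_Rintegral_dominated _ _ _ P _ _ (fun w => h w ^+ 2)).
  + by move=> N; exact: measurable_funX.
  + by move=> w; exact: (cvgM (@cf w) (@cf w)).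
  + exact: sh.2.
  + by move=> N w; rewrite ger0_norm ?sqr_ge0// sqr_le.
Qed.

End integrals_of_rows.

Section laws_of_maps.
Context (R : realType).

Section P2_law.
Context (k : nat) (d0 : measure_display) (T : measurableType d0) (P : probability T R).
Context (Z : T -> 'rV[R]_k) (mZ : measurable_fun setT Z).
Hypothesis sZ : forall j, sqint P (fun w => Z w 0 j).

Lemma image_law_moment : (\int[image_law P mZ]_x (enorm x ^+ 2)%:E < +oo)%E.
Proof.
have me : measurable_fun setT (fun x : 'rV[R]_k => (enorm x ^+ 2)%:E).
  by apply/measurable_EFinP; apply: measurable_enorm2 => j; exact: measurable_entry.
rewrite (integral_law mZ (image_lawP P mZ) me).
have /integrable_fin_num := integrable_enorm2 sZ.
by move=> /(_ measurableT); rewrite ge0_fin_numE// integral_ge0// => w _; rewrite lee_fin sqr_ge0.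
Qed.

Definition P2_law : P2 R k := MkP2 image_law_moment.

Lemma P2_lawP : has_law P Z P2_law. Proof. exact: image_lawP. Qed.

End P2_law.

Lemma sqint_law d1 d2 (T1 : measurableType d1) (T2 : measurableType d2)
    (P : probability T1 R) (Z : T1 -> T2) (Q : probability T2 R) (f : T2 -> R) :
  measurable_fun setT Z -> has_law P Z Q -> sqint Q f -> sqint P (fun w => f (Z w)).
Proof.
move=> mZ lZ [mf f2]; split; first exact: measurableT_comp mf mZ.
exact: (integrable_law mZ lZ f2).
Qed.

Lemma sqint_P2 k (mu : P2 R k) j : sqint mu (fun x => x 0 j).
Proof.
split; first exact: measurable_entry.
have me : mu.-integrable setT (EFin \o (fun x : 'rV[R]_k => enorm x ^+ 2)).
  apply/integrableP; split.
    by apply/measurable_EFinP; apply: measurable_enorm2 => l; exact: measurable_entry.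
  apply: le_lt_trans (P2_moment mu).
  by under eq_integral do rewrite /= ger0_norm ?sqr_ge0//.
apply: integrable_le me _; first by apply: measurable_funX; exact: measurable_entry.
by move=> x; rewrite ger0_norm ?sqr_ge0// sqr_entry_le.
Qed.

Lemma prod_prob_marginal (I : finType) d0 (T : I -> measurableType d0)
    (P : forall i, probability (T i) R) i :
  has_law (prod_prob P) (fun w => w i) (P i).
Proof.
move=> A mA.
pose B j := [set y : T j | forall e : i = j, A (eq_rect_r T y e)].
have BA : B i = A.
  apply/seteqP; split => y /=; first by move=> /(_ erefl).
  by move=> Ay e; rewrite (Prop_irrelevance e erefl).
have BT j : j != i -> B j = setT.
  move=> /eqP ji; apply/seteqP; split => // y _ e; by case: (ji (esym e)).
have mB j : measurable (B j).
  have [ji|ji] := eqVneq j i; last by rewrite BT.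
  by subst j; rewrite BA.
have -> : (fun w : dprod T => w i) @^-1` A = [set f | forall j, B j (f j)].
  apply/seteqP; split => f /=; last by move=> /(_ i erefl).
  by move=> Af j e; subst j.
rewrite (prod_prob_box P mB) (bigD1 i)//= BA big1 ?mule1// => j ji.
by rewrite BT// probability_setT.
Qed.

End laws_of_maps.

(** * The inequality for finitely supported couplings *)

Section pairing_with_velocities.
Context (R : realType) (n : nat) (d : 'I_n -> nat) (v : velocity_field R d).
Hypothesis hv : demicontinuous v.
Local Notation Rd := ('rV[R]_(\sum_(i < n) d i)).
Local Notation X := (dprod (fun i => 'rV[R]_(d i))).
Local Notation E := (fun i => ('rV[R]_(d i) * 'rV[R]_(d i))%type).

Section on_a_probability_space.
Context (dO : measure_display) (O : measurableType dO) (P : probability O R).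

Lemma integrable_pairing (A : O -> Rd) (rho : P2bar R d) (F : O -> X) :
  (forall j, sqint P (fun w => A w 0 j)) ->
  measurable_fun setT F -> has_law P F (prod_prob rho) ->
  P.-integrable setT (EFin \o (fun w => dotp (A w) (field_at v rho (concat (F w))))).
Proof.
by move=> sA mF lF; apply: integrable_dotp => // j; exact: (sqint_vel hv mF lF j).
Qed.

Lemma integral_pairing_sub (A : O -> Rd) (rho0 rho1 : P2bar R d) (F0 F1 : O -> X) :
  (forall j, sqint P (fun w => A w 0 j)) ->
  measurable_fun setT F0 -> has_law P F0 (prod_prob rho0) ->
  measurable_fun setT F1 -> has_law P F1 (prod_prob rho1) ->
  (\int[P]_w (dotp (A w) (field_at v rho0 (concat (F0 w)) -
                          field_at v rho1 (concat (F1 w))))%:E)%E =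
  (\int[P]_w dotp (A w) (field_at v rho0 (concat (F0 w))) -
   \int[P]_w dotp (A w) (field_at v rho1 (concat (F1 w))))%:E.
Proof.
move=> sA mF0 lF0 mF1 lF1.
have i0 := integrable_pairing sA mF0 lF0.
have i1 := integrable_pairing sA mF1 lF1.
rewrite -RintegralB// fineK; last first.
  exact: (integrable_fin_num measurableT (integrableB measurableT i0 i1)).
apply: eq_integral => w _; congr (_%:E).
by rewrite /dotp -sumrB; apply: eq_bigr => j _; rewrite !mxE mulrBr.
Qed.

End on_a_probability_space.

Lemma concatE (x : X) j : concat x 0 j = x (tagnat.sig1 j) 0 (tagnat.sig2 j).
Proof. by rewrite /concat mxE. Qed.

Definition coupled_fst (w : coupled_space R d) : X := fun i => (w i).1.
Definition coupled_snd (w : coupled_space R d) : X := fun i => (w i).2.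

Lemma measurable_coupled_fst : measurable_fun setT coupled_fst.
Proof. exact: (@measurable_dprod_map _ _ _ E _ (fun i => @fst _ _) (fun i => measurable_fst)). Qed.

Lemma measurable_coupled_snd : measurable_fun setT coupled_snd.
Proof. exact: (@measurable_dprod_map _ _ _ E _ (fun i => @snd _ _) (fun i => measurable_snd)). Qed.

Variable lambda : R.
Hypothesis hopt : forall (rho0 rho1 : P2bar R d)
    (g : forall i, probability (E i) R),
  optimal_couplings rho0 rho1 g ->
  (lambda%:E * \int[prod_prob g]_w (enorm (xpart w - ypart w) ^+ 2)%:E
   <= - \int[prod_prob g]_w (dotp (xpart w - ypart w)
     (field_at v rho0 (xpart w) - field_at v rho1 (ypart w)))%:E)%E.

Section finitely_supported.
Variables (g : forall i, probability (E i) R) (q : forall i, E i -> E i).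
Hypothesis fq : forall i, finite_set (range (@q i)).
Hypothesis s1 : forall i j, sqint (g i) (fun p => (q p).1 0 j).
Hypothesis s2 : forall i j, sqint (g i) (fun p => (q p).2 0 j).

Definition interp (t : R) i (p : E i) : 'rV[R]_(d i) := segment t (q p).

Lemma sqint_interp t i j : sqint (g i) (fun p => interp t p 0 j).
Proof.
rewrite /interp /segment; under eq_fun do rewrite !mxE.
apply: sqintD; exact: sqintZ.
Qed.

Lemma finite_interp t i : finite_set (range (@interp t i)).
Proof.
apply: (@sub_finite_set _ _ (segment t @` range (@q i))); last exact: finite_image.
by move=> _ [p _ <-]; exists (q p) => //; exists p.
Qed.

Lemma measurable_interp t i : measurable_fun setT (@interp t i).
Proof.
apply: measurable_finite_range; first exact: finite_interp.
by move=> j; case: (sqint_interp t j).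
Qed.

Definition interp_law (t : R) : P2bar R d :=
  fun i => P2_law (@measurable_interp t i) (@sqint_interp t i).

Definition interp_map (t : R) (w : coupled_space R d) : X := fun i => interp t (w i).

Lemma measurable_interp_map t : measurable_fun setT (interp_map t).
Proof. exact: (@measurable_dprod_map _ _ _ _ _ _ (fun i => @measurable_interp t i)). Qed.

Lemma interp_mapP t : has_law (prod_prob g) (interp_map t) (prod_prob (interp_law t)).
Proof.
apply: prod_prob_law => i; first exact: measurable_interp.
exact: P2_lawP.
Qed.

Let Delta (w : coupled_space R d) : Rd := concat (fun i => (q (w i)).2 - (q (w i)).1).
Let phi t := \int[prod_prob g]_w
  dotp (Delta w) (field_at v (interp_law t) (concat (interp_map t w))).
Let K := \int[prod_prob g]_w (enorm (Delta w) ^+ 2).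

Let sDelta j : sqint (prod_prob g) (fun w => Delta w 0 j).
Proof.
pose i := tagnat.sig1 j; pose l := tagnat.sig2 j.
have -> : (fun w => Delta w 0 j) = (fun w => ((q (w i)).2 - (q (w i)).1) 0 l).
  by apply/funext => w; rewrite /Delta concatE.
apply: (sqint_law (@measurable_dprod_proj _ _ E i) (@prod_prob_marginal _ _ _ E g i)
  (f := fun p => ((q p).2 - (q p).1) 0 l)).
by apply: sqint_entryB; [exact: s2|exact: s1].
Qed.

Let interp_mapB s t w : concat (interp_map t w) - concat (interp_map s w) = (t - s) *: Delta w.
Proof.
apply/rowP => j; rewrite /Delta /concat /interp_map /interp /segment !mxE.
ring.
Qed.

(** For [s] close to [t] the positions at times [t] and [s] are optimally coupled, and
    they differ by (t - s) (y - x); the inequality along optimal couplings then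
    compares the two values. *)
Lemma interp_step (t : R) : \forall s \near t,
  ((phi s + lambda * s * K) - (phi t + lambda * t * K)) * (s - t) <= 0.
Proof.
pose Q i s := forall p p' : E i, range (@q i) p -> range (@q i) p' ->
  enorm (segment t p - segment s p) ^+ 2 <= enorm (segment t p' - segment s p) ^+ 2.
have near_Q : \forall s \near t, forall i, Q i s.
  apply: (@filter_forall _ _ Q (nbhs t)) => i; exact: near_nearest_finite.
apply: filterS near_Q => s hs.
pose G i := joint_law (g i) (@measurable_interp t i) (@measurable_interp s i).
have oG : optimal_couplings (interp_law t) (interp_law s) G.
  move=> i; apply: nearest_point_optimal.
  - exact: finite_interp.
  - exact: P2_lawP.
  - exact: P2_lawP.
  - by move=> w w0; apply: hs; [exists w|exists w0].
have mp i : measurable_fun setT (fun p : E i => (interp t p, interp s p)).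
  by apply: measurable_fun_pair; exact: measurable_interp.
have lG := prod_prob_law mp
  (fun i => joint_lawP (g i) (@measurable_interp t i) (@measurable_interp s i)).
have mG := measurable_dprod_map mp.
have mxy j : measurable_fun setT (fun w : coupled_space R d => (xpart w - ypart w) 0 j).
  pose i := tagnat.sig1 j; pose l := tagnat.sig2 j.
  have -> : (fun w : coupled_space R d => (xpart w - ypart w) 0 j) =
      (fun w => (w i).1 0 l - (w i).2 0 l) by apply/funext => w; rewrite !mxE.
  apply: measurable_funB.
    exact: measurableT_comp (measurableT_comp (measurable_entry _) measurable_fst)
      (@measurable_dprod_proj _ _ E (tagnat.sig1 j)).
  exact: measurableT_comp (measurableT_comp (measurable_entry _) measurable_snd)
      (@measurable_dprod_proj _ _ E (tagnat.sig1 j)).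
have me : measurable_fun setT
    (fun w : coupled_space R d => (enorm (xpart w - ypart w) ^+ 2)%:E).
  by apply/measurable_EFinP; exact: measurable_enorm2.
have md : measurable_fun setT (fun w : coupled_space R d => (dotp (xpart w - ypart w)
     (field_at v (interp_law t) (xpart w) - field_at v (interp_law s) (ypart w)))%:E).
  apply/measurable_EFinP; apply: measurable_dotp => // j.
  have -> : (fun w : coupled_space R d =>
      (field_at v (interp_law t) (xpart w) - field_at v (interp_law s) (ypart w)) 0 j) =
      (fun w => vel v (interp_law t) j (coupled_fst w) - vel v (interp_law s) j (coupled_snd w)).
    by apply/funext => w; rewrite entryB.
  apply: measurable_funB.
    exact: measurableT_comp (measurable_vel hv (interp_law t) j) measurable_coupled_fst.
  exact: measurableT_comp (measurable_vel hv (interp_law s) j) measurable_coupled_snd.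
have := hopt oG.
rewrite (integral_law mG lG me) (integral_law mG lG md).
pose x r w := concat (interp_map r w).
rewrite -[X in (_ * X)%E]/(\int[prod_prob g]_w (enorm (x t w - x s w) ^+ 2)%:E)%E.
rewrite -[X in (- X)%E]/(\int[prod_prob g]_w (dotp (x t w - x s w)
  (field_at v (interp_law t) (x t w) - field_at v (interp_law s) (x s w)))%:E)%E.
have sD j : sqint (prod_prob g) (fun w => (x t w - x s w) 0 j).
  have -> : (fun w => (x t w - x s w) 0 j) = (fun w => (t - s) * Delta w 0 j).
    by apply/funext => w; rewrite interp_mapB entryZ.
  exact: sqintZ.
rewrite (integral_enorm2E sD) (integral_pairing_sub sD (measurable_interp_map t) (interp_mapP t)
  (measurable_interp_map s) (interp_mapP s)).
rewrite -EFinM -EFinN lee_fin.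
have iphi r : \int[prod_prob g]_w dotp (x t w - x s w) (field_at v (interp_law r) (x r w)) =
    (t - s) * phi r.
  rewrite /phi -RintegralZl//; last first.
    exact: (integrable_pairing sDelta (measurable_interp_map r) (interp_mapP r)).
  by apply: eq_Rintegral => w _; rewrite interp_mapB dotpZ.
have iK : \int[prod_prob g]_w (enorm (x t w - x s w) ^+ 2) = (t - s) ^+ 2 * K.
  rewrite /K -RintegralZl//; last exact: integrable_enorm2.
  apply: eq_Rintegral => w _; rewrite interp_mapB !enorm_sqr dotpZ.
  by rewrite /dotp !mulr_sumr; apply: eq_bigr => j _; rewrite entryZ; ring.
rewrite !iphi iK; move: (phi s) (phi t) K => a b c h.
rewrite (_ : _ * (s - t) =
  lambda * ((t - s) ^+ 2 * c) - - ((t - s) * b - (t - s) * a)); last by ring.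
by rewrite subr_le0.
Qed.

(** The local comparisons chain up from time 0, where the law is the first marginal,
    to time 1, where it is the second one. *)
Lemma finitely_supported_monotone : lambda * K <= phi 0 - phi 1.
Proof.
have := locally_decreasing01 interp_step; rewrite mulr0 mulr1 mul0r addr0.
by move: (phi 0) (phi 1) K => a b c h; lra.
Qed.

End finitely_supported.

End pairing_with_velocities.

(** * Passage to the limit *)

Section passage_to_the_limit.
Context (R : realType) (n : nat) (d : 'I_n -> nat) (v : velocity_field R d).
Hypothesis hv : demicontinuous v.
Local Notation Rd := ('rV[R]_(\sum_(i < n) d i)).
Local Notation X := (dprod (fun i => 'rV[R]_(d i))).
Local Notation E := (fun i => ('rV[R]_(d i) * 'rV[R]_(d i))%type).
Variables (rho0 rho1 : P2bar R d) (g : forall i, probability (E i) R).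
Hypothesis cg : couplings rho0 rho1 g.

Let lfst i : has_law (g i) fst (rho0 i).
Proof. by move=> A mA; have [<- _] := @cg i A mA. Qed.

Let lsnd i : has_law (g i) snd (rho1 i).
Proof. by move=> A mA; have [_ <-] := @cg i A mA. Qed.

Variable r : nat -> R -> R.
Hypotheses (mr : forall N, measurable_fun setT (r N))
  (fr : forall N, finite_set (range (r N)))
  (cr : forall x, r N x @[N --> \oo] --> x) (lr : forall N x, `|r N x| <= `|x|).

Definition quantize k N (x : 'rV[R]_k) : 'rV[R]_k := \row_j r N (x 0 j).

Definition quantize2 N i (p : E i) : E i := (quantize N p.1, quantize N p.2).

Lemma finite_quantize2 N i : finite_set (range (@quantize2 N i)).
Proof.
have fin k := @finite_rows R k _ (fr N).
apply: (@sub_finite_set _ _ ([set x : 'rV[R]_(d i) | forall j, range (r N) (x 0 j)] `*`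
  [set x : 'rV[R]_(d i) | forall j, range (r N) (x 0 j)])); last exact: finite_setX.
by move=> _ [p _ <-]; split => j /=; rewrite /quantize mxE; [exists (p.1 0 j)|exists (p.2 0 j)].
Qed.

Lemma quantize_cvg dO (O : measurableType dO) (P : probability O R) (x : O -> R) :
  sqint P x ->
  [/\ forall N, sqint P (fun w => r N (x w)),
      \int[P]_w ((r N (x w) - x w) ^+ 2) @[N --> \oo] --> 0 &
      \int[P]_w (r N (x w) ^+ 2) @[N --> \oo] --> \int[P]_w (x w ^+ 2)].
Proof.
move=> sx; have mx := sqint_measurable sx.
have sax : sqint P (fun w => `|x w|).
  by apply: sqint_le sx _ => [|w]; [exact: measurableT_comp|rewrite normr_id].
have mrx N : measurable_fun setT (fun w => r N (x w)) by exact: measurableT_comp (mr N) mx.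
by have [] := cvg_sqr_dominated mrx sax (fun w => @cr (x w)) (fun N w => lr N (x w)).
Qed.

Let sx i j : sqint (g i) (fun p => p.1 0 j).
Proof. exact: (sqint_law measurable_fst (@lfst i) (sqint_P2 (rho0 i) j)). Qed.

Let sy i j : sqint (g i) (fun p => p.2 0 j).
Proof. exact: (sqint_law measurable_snd (@lsnd i) (sqint_P2 (rho1 i) j)). Qed.

Let s1 N i j : sqint (g i) (fun p => (quantize2 N p).1 0 j).
Proof.
have -> : (fun p => (quantize2 N p).1 0 j) = (fun p : E i => r N (p.1 0 j)).
  by apply/funext => p; rewrite mxE.
by have [] := quantize_cvg (@sx i j).
Qed.

Let s2 N i j : sqint (g i) (fun p => (quantize2 N p).2 0 j).
Proof.
have -> : (fun p => (quantize2 N p).2 0 j) = (fun p : E i => r N (p.2 0 j)).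
  by apply/funext => p; rewrite mxE.
by have [] := quantize_cvg (@sy i j).
Qed.

Let qlaw N t : P2bar R d := interp_law (@finite_quantize2 N) (@s1 N) (@s2 N) t.
Let qmap N t : coupled_space R d -> X := interp_map (@quantize2 N) t.
Let qdiff N (w : coupled_space R d) : Rd :=
  concat (fun i => (quantize2 N (w i)).2 - (quantize2 N (w i)).1).
Let diff (w : coupled_space R d) : Rd := ypart w - xpart w.

Let proj_sqint i (f : E i -> R) : sqint (g i) f -> sqint (prod_prob g) (fun w => f (w i)).
Proof.
exact: (sqint_law (@measurable_dprod_proj _ _ E i) (@prod_prob_marginal _ _ _ E g i)).
Qed.

Let qdiff_cvg j :
  [/\ forall N, sqint (prod_prob g) (fun w => qdiff N w 0 j),
      sqint (prod_prob g) (fun w => diff w 0 j),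
      \int[prod_prob g]_w ((qdiff N w 0 j - diff w 0 j) ^+ 2) @[N --> \oo] --> 0 &
      \int[prod_prob g]_w (qdiff N w 0 j ^+ 2) @[N --> \oo] -->
      \int[prod_prob g]_w (diff w 0 j ^+ 2)].
Proof.
pose i := tagnat.sig1 j; pose l := tagnat.sig2 j.
have dE : (fun w => diff w 0 j) = (fun w => (w i).2 0 l - (w i).1 0 l).
  by apply/funext => w; rewrite /diff entryB !mxE.
have qE N : (fun w => qdiff N w 0 j) = (fun w => r N ((w i).2 0 l) - r N ((w i).1 0 l)).
  by apply/funext => w; rewrite /qdiff concatE entryB !mxE.
have sxl := proj_sqint (@sx i l); have syl := proj_sqint (@sy i l).
apply: (@cvg_sqr_dominated _ _ _ _ _ _
  (fun w : coupled_space R d => `|(w i).2 0 l| + `|(w i).1 0 l|)).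
- move=> N; rewrite qE; apply: measurable_funB.
    exact: measurableT_comp (mr N) (sqint_measurable syl).
  exact: measurableT_comp (mr N) (sqint_measurable sxl).
- apply: sqintD.
    apply: (sqint_le _ syl) => [|w]; last by rewrite normr_id.
    exact: measurableT_comp (sqint_measurable syl).
  apply: (sqint_le _ sxl) => [|w]; last by rewrite normr_id.
  exact: measurableT_comp (sqint_measurable sxl).
- move=> w; have := congr1 (fun f => f w) dE => /= ->.
  have -> : (fun N => qdiff N w 0 j) = (fun N => r N ((w i).2 0 l) - r N ((w i).1 0 l)).
    by apply/funext => N; have := congr1 (fun f => f w) (qE N).
  by apply: cvgB; exact: cr.
- move=> N w; have := congr1 (fun f => f w) (qE N) => /= ->.
  by rewrite (le_trans (ler_normB _ _))// lerD.
Qed.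

(** Used at [t = 0] and [t = 1], where the interpolated position is the quantization of
    one of the two marginals, here [sel]. *)
Lemma pairing_cvg (t : R) (sel : forall i, E i -> 'rV[R]_(d i)) (rho : P2bar R d) :
  (forall i, measurable_fun setT (@sel i)) ->
  (forall i, has_law (g i) (@sel i) (rho i)) ->
  (forall N i (p : E i), segment t (quantize2 N p) = quantize N (sel i p)) ->
  \int[prod_prob g]_w dotp (qdiff N w) (field_at v (qlaw N t) (concat (qmap N t w)))
    @[N --> \oo] -->
  \int[prod_prob g]_w dotp (diff w) (field_at v rho (concat (fun i => sel i (w i)))).
Proof.
move=> msel lsel segE.
pose F := @dprod_map _ _ _ E (fun i => 'rV[R]_(d i)) sel.
have mF : measurable_fun setT F by exact: measurable_dprod_map.
have lF : has_law (prod_prob g) F (prod_prob rho) by exact: prod_prob_law.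
have ssel i j : sqint (g i) (fun p => sel i p 0 j).
  exact: (sqint_law (msel i) (@lsel i) (sqint_P2 (rho i) j)).
have mN N := measurable_interp_map (@finite_quantize2 N) (@s1 N) (@s2 N) t.
have lN N := interp_mapP (@finite_quantize2 N) (@s1 N) (@s2 N) t.
have qlaw_cvg : P2bar_cvg (fun N => qlaw N t) rho.
  pose J N i := joint_law (g i)
    (measurable_interp (@finite_quantize2 N) (@s1 N) (@s2 N) t (i := i)) (msel i).
  pose c N i := \int[g i]_p (enorm (quantize N (sel i p) - sel i p) ^+ 2).
  have sq N i j : sqint (g i) (fun p => (quantize N (sel i p) - sel i p) 0 j).
    have -> : (fun p => (quantize N (sel i p) - sel i p) 0 j) =
      (fun p => r N (sel i p 0 j) - sel i p 0 j).
      by apply/funext => p; rewrite entryB mxE.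
    by apply: sqintB => //; have [] := quantize_cvg (@ssel i j).
  apply: (@P2bar_cvg_cost _ _ _ _ _ J c).
  - move=> N i; apply: coupling_joint_law; [exact: P2_lawP|exact: lsel].
  - move=> N i; rewrite cost_joint_law /c -integral_enorm2E//.
    by apply: eq_integral => p _; rewrite /interp segE.
  - move=> i; rewrite /c.
    have -> : (fun N => \int[g i]_p (enorm (quantize N (sel i p) - sel i p) ^+ 2)) =
      (fun N => \sum_j \int[g i]_p ((r N (sel i p 0 j) - sel i p 0 j) ^+ 2)).
      apply/funext => N; rewrite Rintegral_enorm2//; apply: eq_bigr => j _.
      by apply: eq_Rintegral => p _; rewrite entryB mxE.
    have : \sum_j \int[g i]_p ((r N (sel i p 0 j) - sel i p 0 j) ^+ 2) @[N --> \oo]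
      --> \sum_(j < d i) (0 : R).
      by apply: (cvg_big add_continuous) => j _; have [] := quantize_cvg (@ssel i j).
    by rewrite big1.
have map_cvg w : concat (qmap N t w) @[N --> \oo] --> concat (F w).
  apply: cvg_row => j; rewrite concatE.
  have -> : (fun N => concat (qmap N t w) 0 j) =
    (fun N => r N (sel (tagnat.sig1 j) (w (tagnat.sig1 j)) 0 (tagnat.sig2 j))).
    by apply/funext => N; rewrite concatE /qmap /interp_map /interp segE mxE.
  exact: cr.
have -> : (fun N => \int[prod_prob g]_w
    dotp (qdiff N w) (field_at v (qlaw N t) (concat (qmap N t w)))) =
  (fun N => \sum_j \int[prod_prob g]_w (qdiff N w 0 j * vel v (qlaw N t) j (qmap N t w))).
  apply/funext => N; apply: Rintegral_dotp => j; first by have [] := qdiff_cvg j.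
  exact: (sqint_vel hv (@mN N) (@lN N) j).
have -> : \int[prod_prob g]_w dotp (diff w) (field_at v rho (concat (fun i => sel i (w i)))) =
  \sum_j \int[prod_prob g]_w (diff w 0 j * vel v rho j (F w)).
  apply: Rintegral_dotp => j; first by have [] := qdiff_cvg j.
  exact: (sqint_vel hv mF lF j).
apply: (cvg_big add_continuous) => j _.
have [sN sl cN _] := qdiff_cvg j.
exact: (@cvg_Rintegral_mul_vel _ _ _ v hv _ _ (prod_prob g) (fun N => qlaw N t) rho
  (fun N => qmap N t) F qlaw_cvg (fun N => @mN N) mF (fun N => @lN N) lF map_cvg j _ _ sN sl cN).
Qed.

Lemma qdiff_enorm2_cvg :
  \int[prod_prob g]_w (enorm (qdiff N w) ^+ 2) @[N --> \oo] -->
  \int[prod_prob g]_w (enorm (diff w) ^+ 2).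
Proof.
have -> : (fun N => \int[prod_prob g]_w (enorm (qdiff N w) ^+ 2)) =
  (fun N => \sum_j \int[prod_prob g]_w (qdiff N w 0 j ^+ 2)).
  by apply/funext => N; apply: Rintegral_enorm2 => j; have [] := qdiff_cvg j.
rewrite Rintegral_enorm2 => [|j]; last by have [] := qdiff_cvg j.
by apply: (cvg_big add_continuous) => j _; have [] := qdiff_cvg j.
Qed.

Lemma monotone_of_finitely_supported (lambda : R) :
  (forall N, lambda * \int[prod_prob g]_w (enorm (qdiff N w) ^+ 2) <=
     \int[prod_prob g]_w dotp (qdiff N w) (field_at v (qlaw N 0) (concat (qmap N 0 w))) -
     \int[prod_prob g]_w dotp (qdiff N w) (field_at v (qlaw N 1) (concat (qmap N 1 w)))) ->
  (lambda%:E * \int[prod_prob g]_w (enorm (xpart w - ypart w) ^+ 2)%:E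
     <= - \int[prod_prob g]_w
          (dotp (xpart w - ypart w)
                (field_at v rho0 (xpart w) - field_at v rho1 (ypart w)))%:E)%E.
Proof.
move=> hN.
have sD j : sqint (prod_prob g) (fun w => (xpart w - ypart w) 0 j).
  have -> : (fun w : coupled_space R d => (xpart w - ypart w) 0 j) =
      (fun w => -1 * diff w 0 j).
    by apply/funext => w; rewrite /diff !entryB; ring.
  by apply: sqintZ; have [] := qdiff_cvg j.
have l0 : has_law (prod_prob g) (@coupled_fst R n d) (prod_prob rho0).
  exact: (@prod_prob_law R _ _ _ E (fun i => 'rV[R]_(d i)) g (fun i => @fst _ _) rho0
    (fun i => measurable_fst) lfst).
have l1 : has_law (prod_prob g) (@coupled_snd R n d) (prod_prob rho1).
  exact: (@prod_prob_law R _ _ _ E (fun i => 'rV[R]_(d i)) g (fun i => @snd _ _) rho1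
    (fun i => measurable_snd) lsnd).
rewrite (integral_enorm2E sD).
rewrite (integral_pairing_sub hv sD (@measurable_coupled_fst R n d) l0
  (@measurable_coupled_snd R n d) l1).
rewrite -EFinM -EFinN lee_fin.
have c0 := @pairing_cvg 0 (fun i => @fst _ _) rho0 (fun i => measurable_fst) lfst.
have c1 := @pairing_cvg 1 (fun i => @snd _ _) rho1 (fun i => measurable_snd) lsnd.
have neg (f : coupled_space R d -> Rd) : (forall j, sqint (prod_prob g) (fun w => f w 0 j)) ->
  \int[prod_prob g]_w dotp (xpart w - ypart w) (f w) =
  - \int[prod_prob g]_w dotp (diff w) (f w).
  move=> sf; rewrite -[RHS]mulN1r -RintegralZl//; last first.
    by apply: integrable_dotp => // j; have [] := qdiff_cvg j.
  by apply: eq_Rintegral => w _; rewrite -dotpZ /diff scaleN1r opprB.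
rewrite neg => [|j]; last exact: (sqint_vel hv (@measurable_coupled_fst R n d) l0 j).
rewrite neg => [|j]; last exact: (sqint_vel hv (@measurable_coupled_snd R n d) l1 j).
rewrite opprB opprK addrC.
have -> : \int[prod_prob g]_w (enorm (xpart w - ypart w) ^+ 2) =
  \int[prod_prob g]_w (enorm (diff w) ^+ 2).
  apply: eq_Rintegral => w _; rewrite /diff !enorm_sqr; apply: eq_bigr => j _.
  by rewrite !entryB; ring.
have cK : lambda * \int[prod_prob g]_w (enorm (qdiff N w) ^+ 2) @[N --> \oo] -->
    lambda * \int[prod_prob g]_w (enorm (diff w) ^+ 2).
  by apply: cvgM; [exact: cvg_cst|exact: qdiff_enorm2_cvg].
apply: (ler_cvg_to cK (cvgB (c0 _) (c1 _))).
- by move=> N i p; rewrite /segment subr0 scale1r scale0r addr0.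
- by move=> N i p; rewrite /segment subrr scale1r scale0r add0r.
- exact: nearW.
Qed.

End passage_to_the_limit.

Theorem theorem1p2 (R : realType) (n : nat) (hn : (0 < n)%N)
    (d : 'I_n -> nat) (lambda : R) (v : velocity_field R d)
    (hv : demicontinuous v)
    (hopt : forall (rho0 rho1 : P2bar R d)
        (g : forall i, probability ('rV[R]_(d i) * 'rV[R]_(d i))%type R),
      optimal_couplings rho0 rho1 g ->
      (lambda%:E *
         \int[prod_prob g]_w (enorm (xpart w - ypart w) ^+ 2)%:E
       <= - \int[prod_prob g]_w
            (dotp (xpart w - ypart w)
                  (field_at v rho0 (xpart w) - field_at v rho1 (ypart w)))%:E)%E) :
  forall (rho0 rho1 : P2bar R d)
      (g : forall i, probability ('rV[R]_(d i) * 'rV[R]_(d i))%type R),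
    couplings rho0 rho1 g ->
    (lambda%:E *
       \int[prod_prob g]_w (enorm (xpart w - ypart w) ^+ 2)%:E
     <= - \int[prod_prob g]_w
          (dotp (xpart w - ypart w)
                (field_at v rho0 (xpart w) - field_at v rho1 (ypart w)))%:E)%E.
Proof.
move=> rho0 rho1 g cg.
have [r [mr fr cr lr]] := exists_quantizer R.
apply: (@monotone_of_finitely_supported _ _ _ _ hv _ _ _ cg _ mr fr cr lr) => N.
exact: finitely_supported_monotone.
Qed.
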